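(* Let $k \geq 2$ be an integer and let $G$ be a $k$-connected $(K_2 \cup kK_1)$-free graph with $\delta(G) \geq \frac{3(k-1)}{2}$ and $\alpha(G) \leq \frac{|V(G)|}{2}$. Then $G$ is hamiltonian or $G$ is the Petersen graph.
   Context: All graphs are finite, undirected and simple. $\delta(G)$ denotes the minimum degree and $\alpha(G)$ the independence number of $G$. For graphs $R, R'$, $R \cup R'$ is their disjoint union and $kR$ is the disjoint union of $k$ copies of $R$; $K_n$ is the complete graph on $n$ vertices. A graph $G$ is $R$-free if it contains no induced subgraph isomorphic to $R$. A graph is hamiltonian if it contains a spanning cycle. *)

(* Defs.v *)
From mathcomp Require Import all_boot.
Set Implicit Arguments. Unset Strict Implicit. Unset Printing Implicit Defensive.

Section Graphs.
Variable T : finType.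
Implicit Types (e : rel T) (S : {set T}).

Definition simple_graph e := symmetric e /\ irreflexive e.

Definition connected_without e S :=
  forall x y, x \notin S -> y \notin S ->
    connect [rel u v | [&& e u v, u \notin S & v \notin S]] x y.

Definition k_connected (k : nat) e :=
  k < #|T| /\ forall S, #|S| < k -> connected_without e S.

Definition deg e v := #|[set w | e v w]|.

(* minimum degree delta(G) (T nonempty in our uses) *)
Definition min_degree e := \max_(d < #|T|.+1 | [forall v, d <= deg e v]) d.

Definition independent e S := [forall x in S, forall y in S, ~~ e x y].

Definition alpha e := \max_(S : {set T} | independent e S) #|S|.

Definition has_induced_K2_kK1 (k : nat) e :=
  exists u v (W : {set T}),
    [/\ e u v, (u \notin W) && (v \notin W), #|W| = k,
        independent e W & (forall w, w \in W -> ~~ e u w && ~~ e v w)].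

Definition K2_kK1_free k e := ~ has_induced_K2_kK1 k e.

Definition hamiltonian e :=
  exists s : seq T, [/\ uniq s, size s = #|T|, 3 <= size s & cycle e s].

End Graphs.

(* The Petersen graph: Kneser graph K(5,2) -- vertices are the 2-subsets
   of {0,...,4}, adjacent iff disjoint. *)
Definition petersen_vertex := {A : {set 'I_5} | #|A| == 2}.
Definition petersen_adj : rel petersen_vertex :=
  fun A B => [disjoint val A & val B].

Definition is_petersen (T : finType) (e : rel T) :=
  exists f : T -> petersen_vertex,
    bijective f /\ forall x y, e x y = petersen_adj (f x) (f y).

(* Main.v *)
Require Import Defs.
From mathcomp Require Import all_boot zify.
Set Implicit Arguments. Unset Strict Implicit. Unset Printing Implicit Defensive.

(** Let [c] be a longest cycle, [x] a vertex off [c], [X] the set of all vertices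
    off [c], and [F] the union of [X] and the successors on [c] of the neighbours
    of [x].  Chvatal-Erdos arguments show that [F] is independent.  Since the
    graph is (K2 + k K1)-free, a vertex adjacent to [F] ("outer") misses fewer
    than [k] vertices of any set of non-outer vertices, and the non-outer vertices
    are independent; as alpha <= n/2, some two consecutive vertices of [c] are
    both outer (a "run").  Rerouting [c] through [x] gives, for many inner
    vertices [z], another longest cycle that avoids [z] and has the same runs; so
    such a [z] is not adjacent to both ends of a run, and its own successor set,
    applied to a run whose ends see [z] and another inner vertex [l], produces at
    least [|F_z| - k + 1] runs separating [z] from [l].  Comparing this number
    with the room left by the vertices that both ends of a run miss, the bound
    [deg >= 3 (k - 1) / 2] leaves only the case of equality everywhere: [c] then
    splits into paths with three vertices, [k = 3], and the graph is Petersen's. *)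

(* Abstracting the cardinals keeps [zify] from traversing the sets inside. *)
Ltac card_lia :=
  clear; repeat match goal with |- context [card ?A] => move: (card A) => ? end; lia.

(** * Cyclic neighbours and consecutive entries of a sequence *)

Section CyclicSeq.
Variable T : eqType.
Implicit Types (s c : seq T) (a b : T).

Lemma next_cat s1 s2 a b :
  uniq (s1 ++ a :: b :: s2) -> next (s1 ++ a :: b :: s2) a = b.
Proof.
move=> U; have := cycle_next U; case: s1 U => [|h s1] U /=.
  by case/andP => /eqP.
by rewrite rcons_path cat_path /= => /andP [] /andP [] _ /and3P [] _ /eqP.
Qed.

Lemma next_last s a : uniq (a :: s) -> next (a :: s) (last a s) = a.
Proof.
move=> U; have := cycle_next U.
by rewrite /= rcons_path => /andP [] _ /eqP.
Qed.

Lemma prev_cat s1 s2 a b :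
  uniq (s1 ++ a :: b :: s2) -> prev (s1 ++ a :: b :: s2) b = a.
Proof. by move=> U; have := prev_next U a; rewrite next_cat. Qed.

Lemma prev_cat_last s1 s2 a b :
  uniq (a :: s1 ++ b :: s2) -> prev (a :: s1 ++ b :: s2) b = last a s1.
Proof.
elim/last_ind: s1 => [|s1 h _]; first exact: (@prev_cat [::]).
by rewrite cat_rcons last_rcons; apply: (@prev_cat (a :: s1)).
Qed.

Lemma prev_head s a : uniq (a :: s) -> prev (a :: s) a = last a s.
Proof. by move=> U; have := prev_next U (last a s); rewrite next_last. Qed.

(** Positions grow by one along the cycle except at the last entry, whose successor is the head
    [h]. *)
Lemma index_next h s a : uniq (h :: s) -> a \in h :: s ->
  next (h :: s) a != h -> index (next (h :: s) a) (h :: s) = (index a (h :: s)).+1.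
Proof.
move=> U ac; rewrite next_nth ac => nh.
have i_lt : index a (h :: s) < size s.
  by rewrite ltnNge; apply/negP => le; rewrite nth_default ?eqxx in nh.
rewrite -[nth h s _]/(nth h (h :: s) (index a (h :: s)).+1) index_uniq //.
Qed.

(** The order of the two entries is ignored, so that the relation survives reversing an arc. *)
Fixpoint consec s a b : bool :=
  if s is u :: s' then
    (if s' is w :: _ then ((u == a) && (w == b)) || ((u == b) && (w == a)) else false)
      || consec s' a b
  else false.

(** An entry other than [a] and [b] cuts the list; this lets inner vertices be moved or dropped
    without affecting adjacencies of outer ones. *)
Lemma consec_mid s1 s2 z a b : z != a -> z != b ->
  consec (s1 ++ z :: s2) a b = consec s1 a b || consec s2 a b.
Proof.
move=> /negPf za /negPf zb; elim: s1 => [|u [|w s1] IH].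
- by case: s2 => //= w s2; rewrite za zb.
- by move: IH; rewrite /= za zb !andbF.
by rewrite -[in RHS]/(_ || _) -orbA -IH.
Qed.

Lemma consec_cat s1 s2 a b h1 h2 :
  consec (rcons s1 h1 ++ h2 :: s2) a b =
  [|| consec (rcons s1 h1) a b, (h1 == a) && (h2 == b) || (h1 == b) && (h2 == a)
    | consec (h2 :: s2) a b].
Proof.
elim: s1 => [|u [|w s1] IH].
- by [].
- by rewrite /= ?orbF -!orbA.
by rewrite /= in IH *; rewrite IH -!orbA.
Qed.

Lemma consec_rev s a b : consec (rev s) a b = consec s a b.
Proof.
elim: s => //= u [|w s] IH //.
rewrite rev_cons -cats1 (rev_cons w) consec_cat -rev_cons IH /= orbF.
by rewrite orbC; congr (_ || _); rewrite orbC; congr (_ || _); rewrite andbC.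
Qed.

Lemma consecP s a b : uniq s ->
  reflect (exists s1 s2, s = s1 ++ a :: b :: s2 \/ s = s1 ++ b :: a :: s2) (consec s a b).
Proof.
move=> _; apply: (iffP idP); last first.
  by move=> [s1 [s2 [|]]] ->; elim: s1 => [|u s1 IH] /=; rewrite ?IH ?eqxx ?orbT.
elim: s => //= u [|w s] IH //= /orP [/orP [] /andP [/eqP -> /eqP ->]|].
- by exists [::], s; left.
- by exists [::], s; right.
by move=> /IH [s1 [s2 [|]]] ->; exists (u :: s1), s2; [left|right].
Qed.

(** Membership is asked for because [next] fixes every element outside the sequence. *)
Definition cyc_adj c a b :=
  [&& a \in c, b \in c & (next c a == b) || (next c b == a)].

Lemma cyc_adj_rot i c a b : uniq c -> cyc_adj (rot i c) a b = cyc_adj c a b.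
Proof. by move=> U; rewrite /cyc_adj !mem_rot !next_rot. Qed.

Lemma cyc_adj_rev c a b : uniq c -> cyc_adj (rev c) a b = cyc_adj c a b.
Proof.
move=> U; rewrite /cyc_adj !mem_rev !next_rev // orbC; congr [&& _, _ & _].
by congr (_ || _); apply/eqP/eqP => <-; rewrite ?prev_next ?next_prev.
Qed.

Lemma next_splitP h s a b : uniq (h :: s) -> a \in h :: s -> h != b ->
  next (h :: s) a = b -> exists s1 s2, h :: s = s1 ++ a :: b :: s2.
Proof.
move=> U ac hb; have := next_last U; rewrite -[last h s]/(last h (h :: s)).
case: (h :: s) / (splitPr ac) U => s1 [|w s2] U.
  by rewrite last_cat /= => -> E; rewrite E eqxx in hb.
by rewrite (next_cat U) => _ <-; exists s1, s2.
Qed.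

(** Opening the cycle at a third vertex breaks no adjacency between [a] and [b]. *)
Lemma cyc_adj_consec h s a b : uniq (h :: s) -> h != a -> h != b ->
  cyc_adj (h :: s) a b = consec s a b.
Proof.
move=> U ha hb.
have <- : consec (h :: s) a b = consec s a b.
  by have := consec_mid [::] s ha hb.
apply/idP/(consecP _ _ U).
  case/and3P => ac bc /orP [] /eqP nb.
    by have [s1 [s2 E]] := next_splitP U ac hb nb; exists s1, s2; left.
  by have [s1 [s2 E]] := next_splitP U bc ha nb; exists s1, s2; right.
rewrite /cyc_adj => -[s1 [s2 [|]]] E; rewrite E in U *;
  by rewrite !mem_cat !inE !eqxx next_cat // eqxx !orbT.
Qed.

Lemma split_index_lt s a b : a \in s -> b \in s -> index a s < index b s ->
  exists s1 s2 s3, s = s1 ++ a :: s2 ++ b :: s3.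
Proof.
elim: s => //= h s IH; rewrite !inE !(eq_sym _ h).
case: (eqVneq h a) => [->|_] /=.
  by case: (eqVneq a b) => //= _ _ /splitPr [s2 s3] _; exists [::], s2, s3.
case: (eqVneq h b) => //= _ ia ib; rewrite ltnS => /(IH ia ib) [s1 [s2 [s3 ->]]].
by exists (h :: s1), s2, s3.
Qed.

End CyclicSeq.

Lemma card_setIdC (T : finType) (A : {set T}) (P : pred T) :
  #|[set z in A | P z]| + #|[set z in A | ~~ P z]| = #|A|.
Proof.
rewrite -(cardsID [set z | P z] A); congr (_ + _); apply: eq_card => z; rewrite !inE //.
by rewrite andbC.
Qed.

(** * An explicit list of the vertices of the Petersen graph *)

Lemma pair_card (i j : 'I_5) : i != j -> #|[set i; j]| == 2.
Proof. by move=> h; rewrite cards2 h. Qed.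

Definition pair_vertex (i j : 'I_5) (h : i != j) : petersen_vertex :=
  exist _ [set i; j] (pair_card h).

Lemma pair_vertex_adj (i j i' j' : 'I_5) (h : i != j) (h' : i' != j') :
  petersen_adj (pair_vertex h) (pair_vertex h') =
  [&& val i != val i', val i != val j', val j != val i' & val j != val j'].
Proof.
rewrite /petersen_adj /= -setI_eq0 setIUl setU_eq0 !setI_eq0 !disjoints1 !inE.
by rewrite !negb_or -!andbA !val_eqE.
Qed.

Lemma card_petersen_vertex : #|{: petersen_vertex}| = 10.
Proof.
rewrite card_sig; have := card_draws 'I_5 2; rewrite card_ord cardsE => E.
exact: E.
Qed.

(** The pair 01 comes first; the other nine follow along a 9-cycle on which the neighbours 24, 23,
    34 of 01 occupy every third place. The extremal graph is met in this order at the end. *)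
Definition petersen_list : seq petersen_vertex :=
  let o m (h : m < 5) := Ordinal h in
  let p i j (hi : i < 5) (hj : j < 5) (h : o i hi != o j hj) := pair_vertex h in
  [:: p 0 1 isT isT isT; p 0 2 isT isT isT; p 1 3 isT isT isT; p 2 4 isT isT isT;
      p 0 3 isT isT isT; p 1 4 isT isT isT; p 2 3 isT isT isT; p 0 4 isT isT isT;
      p 1 2 isT isT isT; p 3 4 isT isT isT].

Lemma petersen_list_uniq : uniq petersen_list.
Proof.
pose o m (h : m < 5) := Ordinal h.
(* The incidence vectors of the ten pairs are told apart by computation. *)
apply: (@map_uniq _ _ (fun v : petersen_vertex =>
  [:: o 0 isT \in val v; o 1 isT \in val v; o 2 isT \in val v;
      o 3 isT \in val v; o 4 isT \in val v])).
by rewrite /= !in_set2.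
Qed.

(** * Rerouting a longest cycle through outside vertices *)

Section LongestCycles.
Variables (T : finType) (e : rel T) (k : nat).
Hypotheses (esym : symmetric e) (eirr : irreflexive e).
Implicit Types (c P Q : seq T) (I : {set T}).

Definition longest c :=
  [/\ uniq c, cycle e c, 2 < size c &
      forall c', uniq c' -> cycle e c' -> size c' <= size c].

Lemma path_rev_cons y b Q :
  path e y (rev (b :: Q)) = e y (last b Q) && path e b Q.
Proof.
rewrite lastI rev_rcons /= rev_path; congr (_ && _).
by apply: eq_path => u v; rewrite esym.
Qed.

Lemma last_rev_cons y b Q : last y (rev (b :: Q)) = b.
Proof. by rewrite rev_cons last_rcons. Qed.

Lemma longest_rot i c : longest c -> longest (rot i c).
Proof. by case=> *; split; rewrite ?rot_uniq ?rot_cycle ?size_rot. Qed.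

Lemma longest_rev c : longest c -> longest (rev c).
Proof.
case=> U C *; split; rewrite ?rev_uniq ?size_rev //.
by rewrite rev_cycle (eq_cycle (e' := e)) // => u v; rewrite esym.
Qed.

Lemma not_longer c c' : longest c -> uniq c' -> cycle e c' -> size c < size c' -> False.
Proof. by case=> _ _ _ h U C; rewrite ltnNge h. Qed.

Lemma longest_eq c c' : longest c -> uniq c' -> cycle e c' -> size c' = size c ->
  longest c'.
Proof. by case=> _ _ s2 h U C E; split => //; rewrite E. Qed.

(** The outside path could be inserted between [last s B] and its cyclic successor [s]. *)
Lemma no_bridge_succ s B h p : longest (s :: B) -> uniq (h :: p) -> path e h p ->
  ~~ has (mem (s :: B)) (h :: p) -> e (last s B) h -> e (last h p) s -> False.
Proof.
move=> L U hp D e1 e2; case: (L) => Uc Cc _ _.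
apply: (@not_longer _ ((s :: B) ++ (h :: p)) L); last by rewrite [X in _ < X]size_cat -[X in X < _]addn0 ltn_add2l.
  by rewrite cat_uniq Uc D U.
move: Cc; rewrite /= !rcons_path cat_path /= last_cat /= => /andP [-> _].
by rewrite e1 hp e2.
Qed.

(** The Chvatal-Erdos exchange: [last s P] and [last t Q] precede [t] and [s] on the cycle. Follow
    [s :: P], the outside path, then [t :: Q] backwards, and close with the edge from [t] to [s]. *)
Lemma no_bridge_cross s P t Q h p : longest ((s :: P) ++ (t :: Q)) ->
  uniq (h :: p) -> path e h p -> ~~ has (mem ((s :: P) ++ (t :: Q))) (h :: p) ->
  e (last s P) h -> e (last h p) (last t Q) -> e s t -> False.
Proof.
move=> L U hp D e1 e2 e3; case: (L) => Uc Cc _ _.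
have pe : perm_eq ((s :: P) ++ (h :: p) ++ rev (t :: Q)) (((s :: P) ++ (t :: Q)) ++ h :: p).
  by rewrite -catA perm_cat2l perm_catC perm_cat2r perm_rev.
apply: (@not_longer _ ((s :: P) ++ (h :: p) ++ rev (t :: Q)) L).
- by rewrite (perm_uniq pe) cat_uniq Uc D U.
- move: Cc; rewrite /= !rcons_path cat_path /= last_cat /=.
  case/andP=> /and3P [sP _ tQ] _.
  rewrite cat_path sP /= e1 cat_path hp path_rev_cons e2 tQ /=.
  by rewrite last_cat /= last_cat last_rev_cons esym.
by rewrite (perm_size pe) [X in _ < X]size_cat -[X in X < _]addn0 ltn_add2l.
Qed.

(** The same exchange, with a second outside vertex [y] in place of the edge from [t] to [s]. *)
Lemma no_double_cross s P t Q x y : longest ((s :: P) ++ (t :: Q)) ->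
  x \notin (s :: P) ++ (t :: Q) -> y \notin (s :: P) ++ (t :: Q) -> x != y ->
  e x (last s P) -> e x (last t Q) -> e y s -> e y t -> False.
Proof.
move=> L xc yc xy e1 e2 e3 e4; case: (L) => Uc Cc _ _.
have pe : perm_eq ((s :: P) ++ (x :: rev (t :: Q)) ++ [:: y])
    (((s :: P) ++ (t :: Q)) ++ [:: x; y]).
  rewrite -catA perm_cat2l -[x :: _]cat1s -catA perm_catCA.
  by rewrite perm_cat2r perm_rev.
apply: (@not_longer _ ((s :: P) ++ (x :: rev (t :: Q)) ++ [:: y]) L).
- by rewrite (perm_uniq pe) cat_uniq Uc /= !(negPf xc, negPf yc) inE xy.
- move: Cc; rewrite /= !rcons_path cat_path /= last_cat /=.
  case/andP=> /and3P [sP _ tQ] _.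
  rewrite cat_path sP /= esym e1 cat_path path_rev_cons e2 tQ last_rev_cons /=.
  by rewrite esym e4 /= !last_cat /= !last_cat.
by rewrite (perm_size pe) [X in _ < X]size_cat -[X in X < _]addn0 ltn_add2l.
Qed.

Lemma indepP I : reflect {in I &, forall y z, ~~ e y z} (independent e I).
Proof.
by apply: (iffP forall_inP) => [h y z /h /forall_inP|h y yI]; [|apply/forall_inP => z]; auto.
Qed.

(** * Freeness as a bound on missed vertices; existence of a longest cycle *)

Hypothesis free : K2_kK1_free k e.

Lemma free_card o y I : e o y -> independent e I ->
  {in I, forall z, ~~ e o z && ~~ e y z} -> #|I| < k.
Proof.
move=> eoy /indepP iI h; rewrite ltnNge; apply/negP => /card_geqP [s [Us ss sI]].
apply: free; exists o, y, [set z in s]; split.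
- by [].
- by rewrite !inE; apply/andP; split; apply/negP => /sI /h; rewrite ?eoy // esym eoy andbF.
- by rewrite cardsE; apply/eqP; rewrite -ss; apply/eqP/card_uniqP.
- by apply/indepP => u v; rewrite !inE => /sI uI /sI vI; apply: iI.
by move=> w; rewrite inE => /sI /h.
Qed.

(** Freeness is applied to the edge [o y]: as a member of [I], the vertex [y] misses all of [I]. *)
Lemma missed_card o y I : independent e I -> y \in I -> e o y ->
  #|[set z in I | ~~ e o z]| < k.
Proof.
move=> iI yI eoy; apply: (free_card eoy).
  by apply/indepP => u v; rewrite !inE => /andP [uI _] /andP [vI _]; apply: (indepP _ iI).
by move=> z; rewrite inE => /andP [zI ->]; apply: (indepP _ iI).
Qed.

Hypothesis deg_k : forall v, 3 * (k - 1) <= 2 * deg e v.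
Hypothesis k2 : 2 <= k.

Lemma deg_ge_k v : k <= deg e v.
Proof. by have := deg_k v; lia. Qed.

(** All neighbours of the first vertex [a] of a longest path lie on the path, and one of them is not
    the next vertex, so it closes a cycle on at least three vertices. *)
Lemma exists_longest : 0 < #|T| -> exists c, longest c.
Proof.
case/card_gt0P => v0 _.
pose P1 n := [exists t : n.-tuple T, uniq t && sorted e t].
have P1b n : P1 n -> n <= #|T|.
  by case/existsP => t /andP [U _]; rewrite -(size_tuple t) -(card_uniqP U) max_card.
have P1e : exists n, P1 n.
  by exists 1; apply/existsP; exists [tuple v0].
have [m /existsP [t /andP [Ut st]] mmax] := ex_maxnP P1e P1b.
have mem_max (s : seq T) : uniq s -> sorted e s -> size s <= m.
  by move=> U S; apply: mmax; apply/existsP; exists (in_tuple s); rewrite U.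
case: t Ut st => -[|a s] /= sz.
  by have := mem_max [:: v0] isT isT; rewrite -(eqP sz).
move=> Ut st; have nbr b : e a b -> b \in s.
  move=> ab; apply/negPn/negP => bs.
  have ba : b != a by apply/eqP => E; rewrite E eirr in ab.
  have := mem_max (b :: a :: s); rewrite /= inE negb_or ba bs st esym ab Ut.
  by rewrite -(eqP sz) /= => /(_ isT isT); rewrite ltnn.
case: s sz Ut st nbr => [|h s] sz Ut st nbr.
  have /card_gt0P [b] : 0 < deg e a by have := deg_ge_k a; lia.
  by rewrite inE => /nbr.
have [b bs ab] : exists2 b, b \in s & e a b.
  have : 1 < deg e a by have := deg_ge_k a; lia.
  rewrite /deg (cardsD1 h) => d1.
  have /card_gt0P [b] : 0 < #|[set w | e a w] :\ h|.
    by move: d1; case: (_ \in _) => /=; lia.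
  by rewrite !inE => /andP [bh ab]; exists b => //; move: (nbr _ ab); rewrite inE (negPf bh).
have [c [Uc Cc sc]] : exists c, [/\ uniq c, cycle e c & 2 < size c].
  case/splitPr: bs Ut st => s1 s2 Ut st {nbr sz}.
  exists (a :: h :: rcons s1 b); split; last by rewrite /= size_rcons.
    have : uniq ((a :: h :: rcons s1 b) ++ s2) by rewrite /= cat_rcons.
    by rewrite cat_uniq => /and3P [].
  move: st; rewrite /= -cat_rcons cat_path => /and3P [-> p1 _].
  by rewrite rcons_path p1 last_rcons esym ab.
pose P2 n := [exists t : n.-tuple T, uniq t && cycle e t].
have P2b n : P2 n -> n <= #|T|.
  by case/existsP => t /andP [U _]; rewrite -(size_tuple t) -(card_uniqP U) max_card.
have P2e : exists n, P2 n.
  by exists (size c); apply/existsP; exists (in_tuple c); rewrite Uc.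
have [m2 /existsP [t /andP [U C]] mmax2] := ex_maxnP P2e P2b.
have mem_max2 (s' : seq T) : uniq s' -> cycle e s' -> size s' <= m2.
  by move=> U' S'; apply: mmax2; apply/existsP; exists (in_tuple s'); rewrite U'.
exists t; split => //; rewrite size_tuple //.
exact: leq_trans sc (mem_max2 _ Uc Cc).
Qed.

(** Each of the two arcs ends at the predecessor of the start of the other, as the exchange lemmas
    expect. *)
Lemma rot_to2_at i c s t B : uniq c -> rot i c = s :: B -> t \in c -> s != t ->
  exists P Q, [/\ rot i c = (s :: P) ++ (t :: Q),
     prev c t = last s P & prev c s = last t Q].
Proof.
move=> U E tc st.
have tB : t \in B by move: tc; rewrite -(mem_rot i) E inE eq_sym (negPf st).
have UB : uniq (s :: B) by rewrite -E rot_uniq.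
move: E UB; case/splitPr: tB => P Q E UB.
exists P, Q; rewrite -!(prev_rot i U) E; split => //; first exact: prev_cat_last.
by rewrite prev_head // last_cat.
Qed.

Lemma rot_to2 c s t : uniq c -> s \in c -> t \in c -> s != t ->
  exists i P Q, [/\ rot i c = (s :: P) ++ (t :: Q),
     prev c t = last s P & prev c s = last t Q].
Proof.
move=> U sc tc st; have [i B E] := rot_to sc.
by exists i; apply: rot_to2_at E tc st.
Qed.

(** * Vertices off a longest cycle *)

Hypothesis conn : forall S : {set T}, #|S| < k -> connected_without e S.

(** If [a b] were an edge, let [A] be the set of vertices of [c] attached to its component [H] off
    [c]. Connectivity gives at least [k] of them, and their successors are independent and seen by
    neither [a] nor [b]: a forbidden subgraph. *)
Lemma off_longest_indep c a b : longest c -> a \notin c -> b \notin c -> ~~ e a b.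
Proof.
move=> L ac bc; apply/negP => ab; case: (L) => U C sc _.
pose off := [rel u v | [&& e u v, u \notin c & v \notin c]].
have offsym : connect_sym off.
  by apply: sym_connect_sym => u v /=; rewrite esym andbCA andbC -andbA andbCA.
pose H := [set y | connect off a y].
have aH : a \in H by rewrite inE connect0.
have bH : b \in H by rewrite inE connect1 //= ab ac bc.
have Hc h : h \in H -> h \notin c.
  rewrite inE => /connectP [p pp ->]; elim/last_ind: p pp => //= p u _.
  by rewrite rcons_path last_rcons => /andP [_ /and3P []].
have Hp h h' : h \in H -> h' \in H -> exists p,
    [/\ uniq (h :: p), path e h p, last h p = h' & ~~ has (mem c) (h :: p)].
  move=> hH h'H; have hc := Hc _ hH; move: hH h'H; rewrite !inE offsym => h1 h2.
  case/connectP: (connect_trans h1 h2) => p0 pp0 ->.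
  case/shortenP: pp0 => p pp Up _ {p0}; exists p; split => //.
    by apply: sub_path pp => u v /and3P [].
  rewrite /= negb_or hc /= -all_predC; apply/allP => u.
  elim: p (h) pp {Up h1 h2 hc} => //= w p IH h0 /andP [/and3P [_ _ wc] pp].
  by rewrite inE => /predU1P [-> //|]; apply: IH pp.
pose A := [set u in c | [exists h in H, e h u]].
have Ac u : u \in A -> u \in c by rewrite inE => /andP [].
have AH u : u \in A -> exists2 h, h \in H & e h u.
  by rewrite inE => /andP [_ /exists_inP [h]]; exists h.
have ArA u : u \in A -> next c u \notin A.
  move=> uA; apply/negP => /[dup] vA /Ac vc.
  have [h hH hu] := AH _ uA; have [h' h'H h'v] := AH _ vA.
  have [p [Up pp lp dp]] := Hp _ _ hH h'H.
  have [i B E] := rot_to vc.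
  have UB : uniq (next c u :: B) by rewrite -E rot_uniq.
  have lB : last (next c u) B = u by rewrite -prev_head // -E prev_rot // prev_next.
  apply: (@no_bridge_succ (next c u) B h p) => //.
  - by rewrite -E; apply: longest_rot.
  - by rewrite -E; move: dp; congr (~~ _); apply: eq_has => z; rewrite /= mem_rot.
  - by rewrite lB esym.
  by rewrite lp.
(* [A] holds no two consecutive vertices, so it is not all of [c]; it separates [a] from the rest of
   [c]. *)
have Acard : k <= #|A|.
  rewrite leqNgt; apply/negP => /conn; move/(_ a).
  have [y yc yA] : exists2 y, y \in c & y \notin A.
    case: (c) (ArA) sc (fun u => mem_next c u) => // u0 c' Ar _ mn.
    case: (boolP (u0 \in A)) => uA; last by exists u0; rewrite ?mem_head.
    by exists (next (u0 :: c') u0); [rewrite mem_next mem_head | apply: Ar].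
  have aA : a \notin A by apply/negP => /Ac; rewrite (negPf ac).
  move/(_ y aA yA)/connectP => [p pp ey].
  have: y \in H; last by move/Hc; rewrite yc.
  rewrite ey; elim/last_ind: p pp {ey} => //= p u IH.
  rewrite rcons_path last_rcons => /andP [/IH lH /and3P [eu _ uA]].
  have lc := Hc _ lH.
  have uc : u \notin c.
    by apply: contra uA => uc; rewrite inE uc; apply/exists_inP; exists (last a p).
  by move: lH; rewrite !inE => /connect_trans; apply; apply: connect1; rewrite /= eu lc uc.
have Wi : independent e [set next c u | u in A].
  apply/indepP => _ _ /imsetP [u uA ->] /imsetP [v vA ->].
  case: (eqVneq u v) => [->|uv]; first by rewrite eirr.
  apply/negP => est.
  have nuv : next c u != next c v by apply: contra uv => /eqP /(can_inj (prev_next U)) ->.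
  have [i [P [Q [E lP lQ]]]] := rot_to2 U (etrans (mem_next c u) (Ac _ uA))
    (etrans (mem_next c v) (Ac _ vA)) nuv.
  rewrite !prev_next // in lP lQ.
  have [h hH hu] := AH _ uA; have [h' h'H h'v] := AH _ vA.
  have [p [Up pp lp dp]] := Hp _ _ h'H hH.
  apply: (@no_bridge_cross (next c u) P (next c v) Q h' p) => //.
  - by rewrite -E; apply: longest_rot.
  - by rewrite -E; move: dp; congr (~~ _); apply: eq_has => z; rewrite /= mem_rot.
  - by rewrite -lP esym.
  by rewrite lp -lQ.
have := free_card ab Wi; rewrite card_imset; last exact: can_inj (prev_next U).
rewrite ltnNge Acard => F; suff: ~~ true by []; apply: F => _ /imsetP [u uA ->].
have nuA := ArA _ uA; rewrite -negb_or; apply: contra nuA => h.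
rewrite inE mem_next Ac //=; apply/exists_inP.
by case/orP: h => h; [exists a|exists b].
Qed.

(** * The frame, an independent set attached to an outside vertex *)

Definition succs c x := [set y in c | e x (prev c y)].
Definition frame c x := ~: [set y in c] :|: succs c x.

Lemma in_frame c x y : (y \in frame c x) = (y \notin c) || e x (prev c y).
Proof. by rewrite !inE; case: (y \in c). Qed.

Lemma longest_no_two c x v : longest c -> x \notin c -> e x v -> e x (next c v) -> False.
Proof.
move=> L xc e1 e2; case: (L) => U C sc _.
have vc : v \in c by apply: contraTT e1 => /(off_longest_indep L xc).
rewrite -(mem_next c) in vc; have [i B E] := rot_to vc.
have UB : uniq (next c v :: B) by rewrite -E rot_uniq.
apply: (@no_bridge_succ (next c v) B x [::]) => //=.
- by rewrite -E; apply: longest_rot.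
- by rewrite orbF -E mem_rot.
by rewrite -prev_head // -E prev_rot // prev_next // esym.
Qed.

Lemma card_succs c x : longest c -> x \notin c -> #|succs c x| = deg e x.
Proof.
move=> L xc; case: (L) => U _ _ _.
rewrite /deg -[RHS](card_imset _ (can_inj (prev_next U))).
apply: eq_card => y; apply/idP/imsetP => [|[u]].
  rewrite inE => /andP [yc h].
  by exists (prev c y); rewrite ?inE ?next_prev.
rewrite inE => xu ->; rewrite inE mem_next prev_next // xu andbT.
by apply: contraTT xu => /(off_longest_indep L xc).
Qed.

Lemma card_frame c x : longest c -> x \notin c ->
  #|frame c x| = #|~: [set y in c]| + deg e x.
Proof.
move=> L xc; rewrite -(card_succs L xc) /frame cardsU.
rewrite [_ :&: _](_ : _ = set0) ?cards0 ?subn0 //.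
by apply/setP => y; rewrite !inE; case: (y \in c).
Qed.

Lemma card_off_gt0 c x : x \notin c -> 0 < #|~: [set y in c]|.
Proof. by move=> xc; apply/card_gt0P; exists x; rewrite !inE. Qed.

(** Exchanges settle [x] and the successors. If another vertex [y] off [c] sees a successor [s], a
    second seen successor would allow a double exchange with [x]; so [y] misses [x] and all
    successors but [s], which are at least [k] vertices, too many by freeness. *)
Lemma frame_indep c x : longest c -> x \notin c -> independent e (frame c x).
Proof.
move=> L xc; case: (L) => U _ _ _.
have xs s : s \in succs c x -> ~~ e x s.
  rewrite inE => /andP [sc h]; apply/negP => h2.
  by apply: (longest_no_two L xc h); rewrite next_prev.
have ss : {in succs c x &, forall s t, ~~ e s t}.
  move=> s t; rewrite !inE => /andP [sc hs] /andP [tc ht].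
  case: (eqVneq s t) => [->|st]; first by rewrite eirr.
  have [i [P [Q [E lP lQ]]]] := rot_to2 U sc tc st.
  apply/negP => est; apply: (@no_bridge_cross s P t Q x [::]) => //.
  - by rewrite -E; apply: longest_rot.
  - by rewrite -E /= mem_rot orbF.
  - by rewrite -lP esym.
  by rewrite /= -lQ.
have i0 : independent e (x |: succs c x).
  apply/indepP => y z; rewrite !(inE, in_setU1).
  case/predU1P => [->|ys] /predU1P [->|zs]; rewrite ?eirr //.
  - by apply: xs; rewrite inE.
  - by rewrite esym; apply: xs; rewrite inE.
  by apply: ss; rewrite inE.
have ys y s : y \notin c -> s \in succs c x -> ~~ e y s.
  move=> yc sS; case: (eqVneq x y) => [<-|xy]; first exact: xs.
  apply/negP => eys.
  have := missed_card i0 _ eys; rewrite in_setU1 sS orbT => /(_ isT).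
  apply/negP; rewrite -leqNgt; apply: leq_trans (deg_ge_k x) _.
  rewrite -(card_succs L xc).
  have -> : #|succs c x| = #|x |: succs c x :\ s|.
    rewrite (cardsD1 s (succs c x)) sS cardsU1 !inE (negPf xc) andbF //.
  apply: subset_leq_card; apply/subsetP => z.
  rewrite in_setU1 in_setD1 => /orP [/eqP ->|/andP [zs zS]].
    by rewrite inE setU11 (off_longest_indep L yc xc).
  rewrite inE in_setU1 zS orbT /=; apply/negP => eyz.
  move: sS zS; rewrite !inE eq_sym in zs * => /andP [sc hs] /andP [tc ht].
  have [i [P [Q [E lP lQ]]]] := rot_to2 U sc tc zs.
  apply: (@no_double_cross s P z Q x y) => //; rewrite -?E ?mem_rot -?lP -?lQ //.
  exact: longest_rot.
apply/indepP => y z; rewrite !(in_setU, in_setC) ![_ \in [set _ in c]]inE.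
case/orP => h1 /orP [] h2.
- exact: off_longest_indep h1 h2.
- exact: ys.
- by rewrite esym; apply: ys.
exact: ss.
Qed.

(** * Inner and outer vertices *)

Section Config.
Variables (c : seq T) (x : T).
Hypotheses (L : longest c) (xc : x \notin c).
Let Uc : uniq c. Proof. by case: L. Qed.
Let Cc : cycle e c. Proof. by case: L. Qed.

Definition outer := [set o | [exists y in frame c x, e o y]].

Lemma outerP o : reflect (exists2 y, y \in frame c x & e o y) (o \in outer).
Proof. by rewrite inE; apply: exists_inP. Qed.

Lemma frame_inner y : y \in frame c x -> y \notin outer.
Proof.
move=> yF; apply/outerP => -[z zF]; apply/negP.
exact: (indepP _ (frame_indep L xc)).
Qed.

Lemma x_frame : x \in frame c x.
Proof. by rewrite in_frame xc. Qed.

Lemma succs_frame y : y \in succs c x -> y \in frame c x.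
Proof. by rewrite [in X in _ -> X]inE orbC => ->. Qed.

Lemma succs_inner y : y \in succs c x -> y \notin outer.
Proof. by move/succs_frame/frame_inner. Qed.

Lemma succs_mem y : y \in succs c x -> y \in c.
Proof. by rewrite inE => /andP []. Qed.

Lemma k_lt_frame : k < #|frame c x|.
Proof.
rewrite (card_frame L xc); have := deg_ge_k x; have := card_off_gt0 xc; card_lia.
Qed.

(** Both ends of such an edge would miss the whole frame, which has more than [k] vertices. *)
Lemma inner_indep y z : y \notin outer -> z \notin outer -> ~~ e y z.
Proof.
move=> yO zO; apply/negP => yz.
have := free_card yz (frame_indep L xc); rewrite ltnNge (ltnW k_lt_frame) => F.
suff: ~~ true by []; apply: F => t tF; rewrite -negb_or; apply/negP.
by case/orP => h; [move/outerP: yO | move/outerP: zO]; apply; exists t.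
Qed.

Lemma adj_inner z o : z \notin outer -> e z o -> o \in outer.
Proof. by move=> zO; apply: contraTT => /(inner_indep zO). Qed.

Lemma outer_mem o : o \in outer -> o \in c.
Proof. by apply: contraTT => oc; apply: frame_inner; rewrite in_frame oc. Qed.

(** An outer [o] sees some frame vertex [y], which is inner and so misses all of [I]; freeness is
    applied to the edge [o y]. *)
Lemma missed_outer (I : {set T}) o : {in I, forall z, z \notin outer} ->
  o \in outer -> #|[set z in I | ~~ e o z]| < k.
Proof.
move=> hI /outerP [y yF oy]; apply: (free_card oy).
  apply/indepP => u v; rewrite !inE -!(rwP andP) => -[uI _] [vI _].
  by apply: inner_indep; apply: hI.
move=> z; rewrite inE => /andP [zI ->].
by apply: inner_indep; [apply: frame_inner|apply: hI].
Qed.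

Lemma nbr_mem u : e x u -> u \in c.
Proof. by apply: contraTT => /(off_longest_indep L xc). Qed.

Lemma next_nbr u : e x u -> next c u \in succs c x.
Proof. by move=> xu; rewrite inE mem_next nbr_mem // prev_next. Qed.

Lemma next_inner z : z \in c -> z \notin outer -> next c z \in outer.
Proof. by move=> zc zO; apply: (adj_inner zO); apply: next_cycle. Qed.

Lemma prev_inner z : z \in c -> z \notin outer -> prev c z \in outer.
Proof. by move=> zc zO; apply: (adj_inner zO); rewrite esym; apply: prev_cycle. Qed.

Lemma next_outer_not_nbr f : next c f \in outer -> ~~ e x f.
Proof. by apply: contraTN => /next_nbr /succs_inner. Qed.

(** * Longest cycles avoiding a given inner vertex *)

Definition skips c' z :=
  [/\ longest c', z \notin c', {in outer, forall o, o \in c'} &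
      {in outer &, forall a b, cyc_adj c a b = cyc_adj c' a b}].

Definition skippable z := exists c', skips c' z.

Lemma off_skippable y : y \notin c -> skippable y.
Proof. by move=> yc; exists c; split => // o /outer_mem. Qed.

Lemma rot_rot_ex i j s : exists l, rot i (rot j s) = rot l (s : seq T).
Proof.
case: (leqP (size s) j) => hj; first by exists i; rewrite (rot_oversize hj).
case: (leqP (size s) i) => hi.
  by exists j; rewrite rot_oversize // size_rot.
by eexists; rewrite rot_add_mod ?(ltnW hi) ?(ltnW hj).
Qed.

Lemma rot_swap i P Q : rot i c = P ++ Q -> exists j, rot j c = Q ++ P.
Proof.
move=> E; have [l El] := rot_rot_ex (size P) i c.
by exists l; rewrite -El E rot_size_cat.
Qed.

(** Otherwise [x], [b :: Q] backwards, [a :: P1] backwards and [g :: P2] form a cycle through [x]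
    and all of [c]. *)
Lemma no_cross i a P1 g P2 b Q : rot i c = (a :: P1) ++ (g :: P2) ++ b :: Q ->
  e a g -> e b (last a P1) -> e x (last g P2) -> e x (last b Q) -> False.
Proof.
move=> E ag bf xg xb; have Lr := longest_rot i L.
have [] := Lr; rewrite E => Ur Cr _ _.
have pe : perm_eq (x :: rev (b :: Q) ++ rev (a :: P1) ++ (g :: P2)) (x :: rot i c).
  rewrite E perm_cons perm_catC -catA.
  by apply: perm_cat; [rewrite perm_rev|apply: perm_cat; rewrite ?perm_rev].
apply: (@not_longer _ (x :: rev (b :: Q) ++ rev (a :: P1) ++ (g :: P2)) Lr).
- by rewrite (perm_uniq pe) /= mem_rot xc rot_uniq.
- move: Cr; rewrite /= !rcons_path cat_path /= cat_path /= => /andP [].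
  case/and5P=> pa _ pg _ pb _.
  rewrite cat_path path_rev_cons xb pb last_rev_cons /=.
  rewrite cat_path path_rev_cons bf pa last_rev_cons /= ag pg /=.
  by rewrite last_cat last_rev_cons last_cat last_rev_cons /= esym.
by rewrite (perm_size pe) /=.
Qed.

(** [x] replaces [a]. Every cycle edge created or destroyed meets one of the inner vertices [a],
    [b], [x], so adjacencies between outer vertices persist. *)
Lemma skips_head i a g P2 b Q : rot i c = (a :: g :: P2) ++ b :: Q ->
  a \notin outer -> b \notin outer ->
  e b g -> e x (last g P2) -> e x (last b Q) ->
  skips (x :: rev (b :: Q) ++ g :: P2) a.
Proof.
move=> E aO bO bg xg xb; have Lr := longest_rot i L.
have [] := Lr; rewrite E => Ur Cr _ _.
have pe : perm_eq (x :: rev (b :: Q) ++ g :: P2) (x :: (g :: P2) ++ b :: Q).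
  by rewrite perm_cons perm_catC perm_cat2l perm_rev.
have ar : a \notin (g :: P2) ++ b :: Q by case/andP: Ur.
have xr : x \notin (a :: g :: P2) ++ b :: Q by rewrite -E mem_rot.
have Un : uniq (x :: rev (b :: Q) ++ g :: P2).
  have Ut : uniq ((g :: P2) ++ b :: Q) by case/andP: Ur.
  by rewrite (perm_uniq pe) cons_uniq Ut andbT; move: xr; rewrite inE negb_or => /andP [].
split.
- apply: (longest_eq Lr) => //.
    move: Cr; rewrite /= !rcons_path cat_path /=.
    case/and3P=> _ /and3P [pg _ pb] _.
    rewrite cat_path path_rev_cons xb pb last_rev_cons /= bg pg /=.
    by rewrite last_cat last_rev_cons /= esym.
  by rewrite (perm_size pe) E.
- rewrite (perm_mem pe) inE negb_or ar andbT.
  by apply: contraNneq xr => <-; rewrite mem_head.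
- move=> o oO; rewrite (perm_mem pe) inE orbC.
  move: (outer_mem oO); rewrite -(mem_rot i c) E inE => /predU1P [Eo|->//].
  by rewrite -Eo oO in aO.
move=> u v uO vO.
have ne z t : z \notin outer -> t \in outer -> z != t.
  by move=> zO tO; apply: contraNneq zO => ->.
have xO := frame_inner x_frame.
rewrite -(cyc_adj_rot i) // E cyc_adj_consec ?ne // cyc_adj_consec ?ne //.
rewrite (@consec_mid _ (g :: P2) Q b) ?ne // rev_cons cat_rcons.
by rewrite (@consec_mid _ (rev Q) _ b) ?ne // consec_rev orbC.
Qed.

(** The exchange of [no_cross] with [z] left out between the first two arcs: the length is that of
    [c], and [z] is avoided. *)
Lemma skips_mid i a P1 z g P2 b Q :
  rot i c = (a :: P1) ++ z :: (g :: P2) ++ b :: Q ->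
  a \notin outer -> z \notin outer -> b \notin outer ->
  e a g -> e b (last a P1) -> e x (last g P2) -> e x (last b Q) -> skippable z.
Proof.
move=> E aO zO bO ag bf xg xb; have Lr := longest_rot i L.
have [] := Lr; rewrite E => Ur Cr _ _.
pose c' := x :: rev (b :: Q) ++ rev (a :: P1) ++ g :: P2.
have pe : perm_eq c' (x :: (a :: P1) ++ (g :: P2) ++ b :: Q).
  rewrite perm_cons perm_catC -catA.
  by apply: perm_cat; [rewrite perm_rev|apply: perm_cat; rewrite ?perm_rev].
have pz : perm_eq (rot i c) (z :: (a :: P1) ++ (g :: P2) ++ b :: Q).
  by rewrite E -[z :: _]cat1s -[X in perm_eq _ X]cat1s perm_catCA.
have Uz : uniq (z :: (a :: P1) ++ (g :: P2) ++ b :: Q) by rewrite -(perm_uniq pz) E.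
have xr : x \notin z :: (a :: P1) ++ (g :: P2) ++ b :: Q by rewrite -(perm_mem pz) mem_rot.
have xz : x != z by apply: contraNneq xr => <-; rewrite mem_head.
have Un : uniq c'.
  have Ut : uniq ((a :: P1) ++ (g :: P2) ++ b :: Q) by case/andP: Uz.
  by rewrite (perm_uniq pe) cons_uniq Ut andbT; move: xr; rewrite inE negb_or => /andP [].
exists c'; split.
- apply: (longest_eq Lr) => //.
    move: Cr; rewrite /= !rcons_path cat_path /= cat_path /= => /andP [].
    case/andP=> pa /and5P [_ _ pg _ pb] _.
    rewrite cat_path path_rev_cons xb pb last_rev_cons /=.
    rewrite cat_path path_rev_cons bf pa last_rev_cons /= ag pg /=.
    by rewrite last_cat last_rev_cons last_cat last_rev_cons /= esym.
  by rewrite (perm_size pe) (perm_size pz).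
- rewrite (perm_mem pe) inE negb_or eq_sym xz /=.
  by case/andP: Uz.
- move=> o oO; rewrite (perm_mem pe) inE orbC.
  move: (outer_mem oO); rewrite -(mem_rot i c) (perm_mem pz) inE => /predU1P [Eo|->//].
  by rewrite -Eo oO in zO.
move=> u v uO vO.
have ne y t : y \notin outer -> t \in outer -> y != t.
  by move=> yO tO; apply: contraNneq yO => ->.
have xO := frame_inner x_frame.
rewrite -(cyc_adj_rot i) // E cyc_adj_consec ?ne -?E ?rot_uniq // cyc_adj_consec ?ne //.
rewrite (@consec_mid _ P1 _ z) ?ne // (@consec_mid _ (g :: P2) Q b) ?ne //.
rewrite !rev_cons cat_rcons (@consec_mid _ (rev Q) _ b) ?ne //.
rewrite cat_rcons (@consec_mid _ (rev P1) _ a) ?ne // !consec_rev.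
by rewrite orbA orbC.
Qed.

(** If [x] sees [next c a], take the vertex after that, distinct from [a] since the cycle has at
    least three vertices. Otherwise, failing such a [b], [next c a] would miss [x] and all
    successors but [a], at least [k] inner vertices. *)
Lemma succ_other a : a \in succs c x ->
  exists b, [/\ b \in succs c x, b != a & e (next c a) b].
Proof.
move=> aS; have ac := succs_mem aS; set o := next c a.
have oO : o \in outer by apply: next_inner => //; apply: succs_inner.
case: (boolP (e x o)) => xo.
  exists (next c o); split; first exact: next_nbr.
    rewrite /o; case: L => _ _ s2 _; have [i B E] := rot_to ac.
    have UB : uniq (a :: B) by rewrite -E rot_uniq.
    rewrite -!(next_rot i Uc) E; move: s2 UB; rewrite -(size_rot i) E.
    case: B {E} => [|b1 [|b2 B]] // _ UB.
    rewrite (@next_cat _ [::] (b2 :: B) a b1) // (@next_cat _ [:: a] B b1 b2) //.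
    by move: UB; rewrite /= !inE !negb_or => /and3P [/and3P [_]]; rewrite eq_sym.
  by apply: next_cycle => //; apply: outer_mem.
have : ~~ [forall b in succs c x :\ a, ~~ e o b].
  apply/negP => /forall_inP h.
  have := @missed_outer (x |: succs c x :\ a) o.
  rewrite ltnNge => /(_ _ oO) /negP; case.
    move=> z; rewrite in_setU1 => /orP [/eqP ->|]; first exact: (frame_inner x_frame).
    by rewrite in_setD1 => /andP [_ /succs_inner].
  rewrite [X in k <= #|pred_of_set X|](_ : _ = x |: succs c x :\ a); last first.
    apply/setP => z; rewrite inE in_setU1.
    case: eqP => [->|_] /=; first by rewrite esym.
    by case: (boolP (z \in _)) => //= /h.
  apply: leq_trans (deg_ge_k x) _; rewrite -(card_succs L xc).
  by rewrite (cardsD1 a) aS cardsU1 !inE (negPf xc) andbF.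
rewrite negb_forall => /existsP [b]; rewrite negb_imply negbK in_setD1.
by case/andP => /andP [ba bS] eb; exists b.
Qed.

(** The new cycle is given explicitly because [first_run_step] must know which arc it reverses. *)
Lemma succs_skip i B a b : rot i c = a :: B ->
  a \in succs c x -> b \in succs c x -> b != a ->
  e (next c a) b -> exists P2 Q,
  [/\ rot i c = (a :: next c a :: P2) ++ b :: Q, e x (last (next c a) P2),
      e x (last b Q) & skips (x :: rev (b :: Q) ++ next c a :: P2) a].
Proof.
move=> Ea aS bS ba eb; rewrite eq_sym in ba.
have [P [Q [E lP lQ]]] := rot_to2_at Uc Ea (succs_mem bS) ba.
have UB : uniq ((a :: P) ++ b :: Q) by rewrite -E rot_uniq.
case: P E lP UB => [|g P2] E lP UB.
  move: bS; rewrite inE lP /= => /andP [_ xa].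
  have := indepP _ (frame_indep L xc) x a x_frame (succs_frame aS).
  by rewrite xa.
have g_eq : next c a = g by rewrite -(next_rot i Uc) E (@next_cat _ [::]).
rewrite g_eq in eb *.
have xg : e x (last g P2) by move: bS; rewrite inE lP => /andP [].
have xb : e x (last b Q) by move: aS; rewrite inE lQ => /andP [].
exists P2, Q; split => //.
by apply: (skips_head E) => //; rewrite 1?esym //; apply: succs_inner.
Qed.

Lemma succs_skippable a : a \in succs c x -> skippable a.
Proof.
move=> aS; have [b [bS ba eb]] := succ_other aS.
have [i B E] := rot_to (succs_mem aS).
by have [P2 [Q [_ _ _ sk]]] := succs_skip E aS bS ba eb; eexists; exact: sk.
Qed.

Lemma frame_skippable y : y \in frame c x -> skippable y.
Proof.
case: (boolP (y \in c)) => yc; last by move=> _; apply: off_skippable.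
by rewrite in_frame yc /= => h; apply: succs_skippable; rewrite inE yc.
Qed.

(** * Runs: pairs of consecutive outer vertices *)

Definition runs := [set f in outer | next c f \in outer].

(** The two ends stay consecutive on a longest cycle avoiding [z], where [z] could be inserted
    between them. *)
Lemma run_no_common f z : f \in runs -> skippable z -> e z f -> ~~ e z (next c f).
Proof.
rewrite inE => /andP [fO gO] [c' [L' zc' _ Ec']] zf; apply/negP => zg.
have : cyc_adj c' f (next c f).
  by rewrite -Ec' // /cyc_adj !outer_mem ?eqxx.
case/and3P => _ _ /orP [] /eqP h.
  by apply: (longest_no_two L' zc' zf); rewrite h.
by apply: (longest_no_two L' zc' zg); rewrite h.
Qed.

Lemma frame_lb : 3 * (k - 1) + 2 <= 2 * #|frame c x|.
Proof.
rewrite (card_frame L xc); have := deg_k x; have := card_off_gt0 xc; card_lia.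
Qed.

Lemma outer_succ o : o \in outer -> exists2 a, a \in succs c x & e o a.
Proof.
move=> oO; apply/exists_inP; apply: contraT => h.
have := @missed_outer (succs c x) o (fun z => @succs_inner z) oO.
rewrite ltnNge; apply: contraNT => _; apply: leq_trans (deg_ge_k x) _.
rewrite -(card_succs L xc); apply: subset_leq_card; apply/subsetP => z zS.
rewrite inE zS /=; apply: contra h => oz.
by apply/exists_inP; exists z.
Qed.

(** Three arcs ready for [no_cross], starting at [b], at the second end of the run and at [a]; the
    last two end just before a successor, hence at neighbours of [x]. *)
Lemma run_arcs f (i : nat) (B0 R : seq T) :
  rot i c = next c f :: B0 ++ R -> {subset succs c x <= B0} ->
  forall a b, a \in succs c x -> b \in succs c x -> index a B0 < index b B0 ->
  exists B1 B2 B3, [/\ exists j, rot j c = (b :: B3 ++ R) ++ (next c f :: B1) ++ a :: B2,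
     e x (last (next c f) B1) & e x (last a B2)].
Proof.
move=> E SB a b aS bS lt_ab.
have [B1 [B2 [B3 EB]]] := split_index_lt (SB _ aS) (SB _ bS) lt_ab.
have E1 : rot i c = next c f :: B1 ++ a :: (B2 ++ (b :: B3 ++ R)).
  by rewrite E EB -!catA /= -catA.
have U1 : uniq (rot i c) by rewrite rot_uniq.
exists B1, B2, B3; split.
- have E2 : rot i c = ((next c f :: B1) ++ a :: B2) ++ (b :: B3 ++ R).
    by rewrite E1 -catA.
  by have [j Ej] := rot_swap E2; exists j.
- by move: aS; rewrite inE -(prev_rot i Uc) E1 prev_cat_last -?E1 // => /andP [].
have E2 : rot i c = next c f :: (B1 ++ a :: B2) ++ b :: (B3 ++ R) by rewrite E1 -catA.
by move: bS; rewrite inE -(prev_rot i Uc) E2 prev_cat_last -?E2 // last_cat => /andP [].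
Qed.

(** [o] is the last outer vertex before [f], one or two steps back since inner vertices are never
    consecutive. If [x] saw [o], the next vertex would be a successor; but it is either [f] or
    [prev c f]. *)
Lemma run_cut f : f \in runs -> prev c f \notin succs c x ->
  exists i B0 R o, [/\ rot i c = next c f :: B0 ++ R, {subset succs c x <= B0},
    o \in outer, ~~ e x o &
    (prev c f \in outer /\ R = [:: o; f]) \/
    (prev c f \notin outer /\ R = [:: o; prev c f; f])].
Proof.
rewrite inE => /andP [vO wO] pS.
have vc := outer_mem vO; have wc : next c f \in c by rewrite mem_next.
have pc : prev c f \in c by rewrite mem_prev.
have [i B E] := rot_to wc; have UB : uniq (next c f :: B) by rewrite -E rot_uniq.
have size_c : 2 < size (next c f :: B) by rewrite -E size_rot; case: L.
have lB : last (next c f) B = f by rewrite -prev_head // -E prev_rot // prev_next.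
elim/last_ind: B E UB size_c lB => // B1 f' _ E UB size_c; rewrite last_rcons => Ef'.
rewrite {}Ef' {f'} -cats1 in E UB size_c.
have Ep : prev c f = last (next c f) B1 by rewrite -(prev_rot i Uc) E prev_cat_last.
elim/last_ind: B1 E UB size_c Ep => // B2 p _ E UB size_c; rewrite last_rcons => Ep.
rewrite -Ep -cats1 -catA /= in E UB size_c.
have Sc s : s \in succs c x -> (s \in B2) && (s != prev c f).
  move=> sS; have := succs_mem sS; rewrite -(mem_rot i c) E inE mem_cat !inE.
  have sO := succs_inner sS.
  case: eqP => [Es|_]; first by rewrite -Es (negPf sO) in wO.
  case: eqP => [Es|_ ]; first by rewrite -Es sS in pS.
  by case: eqP => [Es|_]; [rewrite -Es (negPf sO) in vO|rewrite !orbF andbT].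
case: (boolP (prev c f \in outer)) => pO.
  exists i, B2, [:: prev c f; f], (prev c f); split => //.
  - by move=> s /Sc /andP [].
  - by apply: next_outer_not_nbr; rewrite next_prev.
  by left.
have Eo : prev c (prev c f) = last (next c f) B2.
  by rewrite -(prev_rot i Uc) E prev_cat_last.
have oO := prev_inner pc pO.
elim/last_ind: B2 E UB size_c Eo Sc => [|B0 o _] E UB size_c Eo Sc.
  by have [a /Sc] := outer_succ oO.
rewrite last_rcons in Eo; rewrite -Eo -cats1 -catA /= in E UB size_c.
exists i, B0, [:: prev c (prev c f); prev c f; f], (prev c (prev c f)); split => //.
- move=> s sS; have /andP [] := Sc _ sS; rewrite -Eo mem_rcons inE.
  by case: eqP => [Es|//]; rewrite -Es (negPf (succs_inner sS)) in oO.
- by apply: contra pS => h; rewrite inE pc.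
by right.
Qed.

(* In positions counted from the second vertex w of the run (f, w), the
   neighbours of w precede those of f, and these precede the
   neighbours of the last outer vertex before f unless the vertex between can be skipped; three such almost disjoint sets
   do not fit into the successors. *)
Lemma run_prev f : f \in runs -> prev c f \notin outer /\ skippable (prev c f).
Proof.
move=> fR; case: (boolP (prev c f \in succs c x)) => pS.
  by split; [apply: succs_inner|apply: succs_skippable].
have [i [B0 [R [o [E SB oO xo dR]]]]] := run_cut fR pS.
have [fO wO] : f \in outer /\ next c f \in outer by apply/andP; rewrite inE in fR.
set w := next c f in E wO *.
have arcs := run_arcs E SB.
have K1 a b : a \in succs c x -> b \in succs c x -> e f a -> e w b ->
    index a B0 < index b B0 -> False.
  move=> aS bS fa wb lt_ab; have [B1 [B2 [B3 [[j Ej] h1 h2]]]] := arcs _ _ aS bS lt_ab.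
  apply: (no_cross Ej) => //; first by rewrite esym.
  by rewrite last_cat; case: dR => -[_ ->] /=; rewrite esym.
have [/existsP [a /existsP [b /and5P [aS bS oa fb lt_ab]]]|none] := boolP [exists a, exists b,
  [&& a \in succs c x, b \in succs c x, e o a, e f b & index a B0 < index b B0]].
  have [B1 [B2 [B3 [[j Ej] h1 h2]]]] := arcs _ _ aS bS lt_ab.
  have bO := succs_inner bS; have aO := succs_inner aS.
  case: dR => -[pO ER]; rewrite {}ER in Ej.
    exfalso; have Ej' : rot j c = (b :: B3 ++ [:: o]) ++ (f :: w :: B1) ++ a :: B2.
      by rewrite Ej /= -!catA.
    apply: (no_cross Ej') => //; first by rewrite esym.
    by rewrite last_cat /= esym.
  split => //; have Ej' : rot j c =
      (b :: B3 ++ [:: o]) ++ prev c f :: (f :: w :: B1) ++ a :: B2.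
    by rewrite Ej /= -!catA.
  apply: (skips_mid Ej') => //; first by rewrite esym.
  by rewrite last_cat /= esym.
have K2 a b : a \in succs c x -> b \in succs c x -> e o a -> e f b ->
    index a B0 < index b B0 -> False.
  move=> aS bS oa fb lt_ab; move/negP: none; apply.
  by apply/existsP; exists a; apply/existsP; exists b; rewrite aS bS oa fb.
exfalso.
have B0_inj a b : a \in succs c x -> b \in succs c x -> index a B0 = index b B0 -> a = b.
  by move=> aS bS h; rewrite -(nth_index a (SB _ aS)) h nth_index ?SB.
pose N u := [set z in succs c x | e u z].
pose X u := [set z in ~: [set y in c] | e u z].
have Nvw : N f :&: N w = set0.
  apply/setP => z; rewrite !inE; apply/negP => /andP [/andP [zS fz] /andP [_ wz]].
  have := run_no_common fR (@succs_skippable z _); rewrite inE zS ![e z _]esym fz wz.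
  by move/(_ isT isT).
have Xvw : X f :&: X w = set0.
  apply/setP => z; rewrite !inE; apply/negP => /andP [/andP [zS fz] /andP [_ wz]].
  have := run_no_common fR (off_skippable zS); rewrite ![e z _]esym fz wz.
  by move/(_ isT).
(* Two common neighbours, taken in a suitable order, would contradict [K2]. *)
have Nov : #|N o :&: N f| <= 1.
  apply/card_le1_eqP => a b; rewrite !in_setI ![_ \in N _]inE.
  move=> /andP [/andP [aS oa] /andP [_ fa]] /andP [/andP [bS ob] /andP [_ fb]].
  case: (ltngtP (index a B0) (index b B0)) => h.
  - by case: (K2 a b).
  - by case: (K2 b a).
  exact: B0_inj.
(* A single neighbour of [f] suffices to separate those of [o] from those of [w]. *)
have [b bS fb] := outer_succ fO.
have Now : N o :&: N w = set0.
  apply/setP => a; rewrite in_set0 in_setI ![_ \in N _]inE.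
  apply/negP => /andP [/andP [aS oa] /andP [_ wa]].
  case: (ltngtP (index a B0) (index b B0)) => h.
  - by case: (K2 a b).
  - by case: (K1 b a).
  have Eab := B0_inj _ _ aS bS h.
  have : b \in N f :&: N w.
    by rewrite in_setI [b \in N f]inE [b \in N w]inE bS fb -Eab wa.
  by rewrite Nvw in_set0.
have sumN : #|N o| + #|N f| + #|N w| <= #|succs c x| + 1.
  have sub : N o :|: N f :|: N w \subset succs c x.
    by apply/subsetP => z; rewrite !in_setU ![_ \in N _]inE -!andb_orr => /andP [].
  have := subset_leq_card sub; rewrite cardsU setIUl Now Nvw setU0 cards0 subn0 cardsU.
  by move: Nov; have := subset_leq_card (subsetIl (N o) (N f)); card_lia.
have sumX : #|X f| + #|X w| <= #|~: [set y in c]|.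
  have sub : X f :|: X w \subset ~: [set y in c].
    by apply/subsetP => z; rewrite in_setU ![_ \in X _]inE -andb_orr inE => /andP [].
  by have := subset_leq_card sub; rewrite cardsU Xvw cards0 subn0.
have Xo : #|X o| < #|~: [set y in c]|.
  apply: proper_card; apply/properP; split.
    by apply/subsetP => z; rewrite inE => /andP [].
  by exists x; rewrite !inE ?xc // esym (negPf xo).
have bnd u : u \in outer -> #|frame c x| <= #|N u| + #|X u| + (k - 1).
  move=> uO; rewrite -(card_setIdC (frame c x) (e u)).
  have := @missed_outer (frame c x) u (fun z => @frame_inner z) uO.
  have : #|[set z in frame c x | e u z]| <= #|N u| + #|X u|.
    rewrite addnC; apply: leq_trans (leq_card_setU _ _); apply: subset_leq_card.
    by apply/subsetP => z; rewrite !inE; case: (e u z); rewrite ?andbF ?andbT.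
  by have := k2; card_lia.
(* With [d] the degree of [x] and [m] vertices off [c], the sum is [3 * (m + d) <= (d + 1) + (2 * m
   - 1) + 3 * (k - 1)], against [m >= 1] and [2 * d >= 3 * (k - 1)]. *)
have := bnd _ oO; have := bnd _ fO; have := bnd _ wO; rewrite (card_frame L xc).
rewrite (card_succs L xc) in sumN; have := deg_k x.
by move: sumN sumX Xo; have := k2; card_lia.
Qed.

(** A set of inner vertices all known to be skippable, thanks to [run_prev] for the second part. *)
Definition core := frame c x :|: [set prev c f | f in runs].

Lemma core_inner z : z \in core -> z \notin outer.
Proof.
by case/setUP => [/frame_inner //|/imsetP [f fR ->]]; have [] := run_prev fR.
Qed.

Lemma core_skippable z : z \in core -> skippable z.
Proof.
by case/setUP => [/frame_skippable //|/imsetP [f fR ->]]; have [] := run_prev fR.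
Qed.

Definition twice_missed f := [set z in core | ~~ e f z && ~~ e (next c f) z].

(** Being skippable, each core vertex is missed by an end of the run, and each end misses at most
    [k - 1] of them; the two missed sets cover the core and meet in [twice_missed f]. *)
Lemma core_card f : f \in runs -> #|core| + #|twice_missed f| <= 2 * (k - 1).
Proof.
move=> fR; have [fO wO] : f \in outer /\ next c f \in outer by apply/andP; rewrite inE in fR.
have := missed_outer (I := core) (fun z => @core_inner z) fO.
have := missed_outer (I := core) (fun z => @core_inner z) wO.
set M1 := [set _ in _ | _]; set M2 := [set _ in _ | _] => h1 h2.
have EU : M2 :|: M1 = core.
  apply/setP => z; rewrite in_setU [z \in M2]inE [z \in M1]inE -andb_orr -negb_and.
  case: (boolP (z \in core)) => //= zC.
  apply/negP => /andP [fz wz]; have := run_no_common fR (core_skippable zC).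
  by rewrite ![e z _]esym fz wz => /(_ isT).
have EI : M2 :&: M1 = twice_missed f.
  apply/setP => z; rewrite in_setI [z \in M2]inE [z \in M1]inE [RHS]inE.
  by case: (z \in core).
by move: h1 h2; have := cardsUI M2 M1; rewrite EU EI; card_lia.
Qed.

Lemma skips_rev c' z : skips c' z -> skips (rev c') z.
Proof.
case=> L' zc' oc' Ec'; have U' : uniq c' by case: L'.
split; first exact: longest_rev.
- by rewrite mem_rev.
- by move=> o /oc'; rewrite mem_rev.
by move=> a b aO bO; rewrite Ec' // cyc_adj_rev.
Qed.

(** * Runs that separate two inner vertices *)

Section Separation.
Variables (c' : seq T) (z l q0 : T).
Hypotheses (sk : skips c' z) (zO : z \notin outer) (lO : l \notin outer)
  (lS : skippable l) (zq0 : e z q0) (ly0 : e l (next c' q0)).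

(** By [sepsP], such a [y] and its predecessor on [c'] are outer, the first seen by [l], the second
    by [z]: a run separating [z] from [l]. *)
Definition seps := [set y in frame c' z | e l y].

(** [c'] may traverse the run against the direction of [c]; this is the first end in the direction
    of [c]. *)
Definition run_start y := if next c (prev c' y) == y then prev c' y else y.

Lemma seps_card : #|frame c' z| <= #|seps| + (k - 1).
Proof.
have [L' zc' _ _] := sk; have U' : uniq c' by case: L'.
have y0F : next c' q0 \in frame c' z by rewrite in_frame prev_next // zq0 orbT.
have := missed_card (frame_indep L' zc') y0F ly0.
have := card_setIdC (frame c' z) (e l); rewrite -/seps; have := k2; card_lia.
Qed.

Lemma sepsP y : y \in seps ->
  [/\ y \in outer, y \in c', e l y, e z (prev c' y) & prev c' y \in outer].
Proof.
rewrite inE => /andP [yF ly]; have yO := adj_inner lO ly.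
have [L' zc' oc' _] := sk; have yc' := oc' _ yO.
rewrite in_frame yc' /= in yF; split => //.
exact: adj_inner yF.
Qed.

Lemma run_startP y : y \in seps -> run_start y \in runs /\
  (y = next c (run_start y) /\ run_start y = prev c' y
   \/ y = run_start y /\ next c y = prev c' y).
Proof.
move=> yS; have [yO yc' ly zp pO] := sepsP yS.
have [L' zc' _ Ec'] := sk; have U' : uniq c' by case: L'.
have : cyc_adj c (prev c' y) y.
  by rewrite Ec' // /cyc_adj mem_prev yc' next_prev // eqxx.
rewrite /run_start /cyc_adj; case: eqP => [h _|_ /and3P [_ _ /= /eqP h]].
  by split; [rewrite inE pO h yO|left].
by split; [rewrite inE yO h|right].
Qed.

(** The run determines [y], because the skippable [l] sees at most one of its two ends. *)
Lemma prev_run_start_inj : {in seps &, injective (fun y => prev c (run_start y))}.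
Proof.
move=> y y' yS y'S /(can_inj (next_prev Uc)) Es.
have [sR h] := run_startP yS; have [_ h'] := run_startP y'S.
have [_ _ ly _ _] := sepsP yS; have [_ _ ly' _ _] := sepsP y'S.
have nc := run_no_common sR lS.
rewrite -Es in h'; move: (run_start y) sR h h' nc {Es} => s _ h h' nc.
case: h h' => -[Ey _] [] [Ey' _].
- by rewrite Ey Ey'.
- by have := nc; rewrite -Ey -Ey' ly ly' => /(_ isT).
- by have := nc; rewrite -Ey' -Ey ly ly' => /(_ isT).
by rewrite Ey Ey'.
Qed.

End Separation.

(** Otherwise the vertices before runs lie outside the frame and fully enlarge the core. For
    successors [j] and [l] seen by the two ends of a run, [seps] injects into those vertices, and
    [core_card] leaves at most [3 * (k - 1)] for the sum of the two frames of [x] and [j], below the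
    degree bound. *)
Lemma exists_first_run : runs != set0 -> exists2 f, f \in runs & prev c f \in succs c x.
Proof.
case/set0Pn => f fR; apply/exists_inP; apply: contraT; rewrite negb_exists_in.
move/forall_inP => none.
have [fO wO] : f \in outer /\ next c f \in outer by apply/andP; rewrite inE in fR.
have [j jS fj] := outer_succ fO; have [l lS wl] := outer_succ wO.
have [c1 sk1] := succs_skippable jS.
(* The cycle is oriented so as to traverse this run in the direction of [c]. *)
have [c' sk nf] : exists2 c', skips c' j & next c' f = next c f.
  have [L1 _ _ Ec1] := sk1; have U1 : uniq c1 by case: L1.
  have : cyc_adj c1 f (next c f) by rewrite -Ec1 // /cyc_adj !outer_mem ?eqxx.
  case/and3P => _ _ /orP [] /eqP h; first by exists c1.
  by exists (rev c1); [apply: skips_rev | rewrite next_rev // -{1}h prev_next].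
have jO := succs_inner jS; have lO := succs_inner lS; have lsk := succs_skippable lS.
have jf : e j f by rewrite esym.
have lw : e l (next c' f) by rewrite nf esym.
have h1 := seps_card sk jf lw.
have h2 : #|seps c' j l| <= #|[set prev c g | g in runs]|.
  rewrite -(card_in_imset (prev_run_start_inj sk jO lO lsk)); apply: subset_leq_card.
  apply/subsetP => _ /imsetP [y yS ->]; apply: imset_f.
  by have [] := run_startP sk jO lO yS.
have h3 : #|core| = #|frame c x| + #|[set prev c g | g in runs]|.
  rewrite /core cardsU [_ :&: _](_ : _ = set0) ?cards0 ?subn0 //.
  apply/setP => y; rewrite in_set0 in_setI; apply/negP => /andP [yF /imsetP [g gR Ey]].
  move: (none _ gR); rewrite inE mem_prev outer_mem; last by move: gR; rewrite inE => /andP [].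
  by move: yF; rewrite Ey in_frame mem_prev outer_mem //=; [move=> ->|move: gR; rewrite inE => /andP []].
have h4 := core_card fR; have h5 := frame_lb.
have h6 : 3 * (k - 1) + 2 <= 2 * #|frame c' j|.
  have [L' jc' _ _] := sk; rewrite (card_frame L' jc').
  by have := deg_k j; have := card_off_gt0 jc'; card_lia.
by move: h1 h2 h3 h4 h5 h6; have := k2; card_lia.
Qed.

(** * A run preceded by a successor forces equality *)

Section FirstRun.
Variables (r : T) (i : nat) (B : seq T).
Hypotheses (rS : r \in succs c x) (vR : next c r \in runs) (E : rot i c = r :: B).
Let v := next c r.
Let w := next c v.
Let pos y := index y (rot i c).
Let Ur : uniq (rot i c). Proof. by rewrite rot_uniq. Qed.
Let vO : v \in outer. Proof. by move: vR; rewrite inE => /andP []. Qed.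
Let wO : w \in outer. Proof. by move: vR; rewrite inE => /andP []. Qed.

Lemma pos_next y : y \in c -> next c y != r -> pos (next c y) = (pos y).+1.
Proof.
rewrite /pos -(next_rot i Uc) -(mem_rot i c) E => yc ny.
by apply: index_next => //; rewrite -E.
Qed.

Lemma pos_inj y z : y \in c -> z \in c -> pos y = pos z -> y = z.
Proof.
by move=> yc zc h; rewrite -(@nth_index _ r y (rot i c)) ?mem_rot // -/(pos y) h nth_index ?mem_rot.
Qed.

Lemma pos_r y : (pos y == 0) = (r == y).
Proof. by rewrite /pos E /=; case: (r == y). Qed.

Lemma v_not_both y : y \in core -> e v y -> e w y -> False.
Proof.
move=> /core_skippable yS vy wy; have := run_no_common vR yS.
by rewrite ![e y _]esym vy wy => /(_ isT).
Qed.

Lemma succs_core y : y \in succs c x -> y \in core.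
Proof. by move=> yS; rewrite in_setU succs_frame. Qed.

Lemma v_adj_r : e v r. Proof. by rewrite esym; apply: next_cycle => //; apply: succs_mem. Qed.

(** In the opposite order [no_cross] applies, with the run cut between [v] and [w]. The neighbour
    [r] of [v], at position 0, is the exception. *)
Lemma w_pos_lt_v a b : a \in succs c x -> a != r -> e v a ->
  b \in succs c x -> e w b -> pos b < pos a.
Proof.
move=> aS ar va bS wb.
case: (ltngtP (pos b) (pos a)) => // h; last first.
  have Eab := pos_inj (succs_mem bS) (succs_mem aS) h; rewrite Eab in wb.
  by case: (v_not_both (succs_core aS) va wb).
exfalso; have UB := Ur; rewrite E in UB.
have rc := succs_mem rS; have vc := outer_mem vO.
have [B' EB'] : exists B', B = [:: v, w & B'].
  have nr : next (r :: B) r = v by rewrite -E next_rot.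
  have nv : next (r :: B) v = w by rewrite -E next_rot.
  have : 2 < size (r :: B) by rewrite -E size_rot; case: L.
  case: (B) UB nr nv => [|b1 [|b2 B']] // UB.
  rewrite (@next_cat _ [::] (b2 :: B') r b1) // => <-.
  by rewrite (@next_cat _ [:: r] B' b1 b2) // => <- _; exists B'.
have inB' s : s \in succs c x -> s != r -> s \in B' /\ pos s = (index s B').+3.
  move=> sS sr; have := succs_mem sS; rewrite /pos -(mem_rot i c) E EB' !inE (negPf sr).
  have sO := succs_inner sS.
  have sv : s != v by apply: contraNneq sO => ->.
  have sw : s != w by apply: contraNneq sO => ->.
  by rewrite /= ![_ == s]eq_sym (negPf sr) (negPf sv) (negPf sw).
have br : b != r by rewrite eq_sym -pos_r -lt0n; apply: leq_ltn_trans h.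
have [aB' pa] := inB' _ aS ar; have [bB' pb] := inB' _ bS br.
have lt_ab : index a B' < index b B' by move: h; rewrite pa pb !ltnS.
have [B1 [B2 [B3 EB3]]] := split_index_lt aB' bB' lt_ab.
have E1 : rot i c = [:: r, v, w & B1] ++ a :: (B2 ++ b :: B3) by rewrite E EB' EB3.
have E2 : rot i c = ([:: r, v, w & B1] ++ a :: B2) ++ b :: B3 by rewrite E1 -catA.
have [j Ej] := rot_swap E2.
have Ej' : rot j c = (b :: B3 ++ [:: r; v]) ++ (w :: B1) ++ a :: B2.
  by rewrite Ej /= -!catA.
apply: (no_cross Ej').
- by rewrite esym.
- by rewrite last_cat /= esym.
- have U1 := Ur; rewrite E1 in U1.
  by move: aS; rewrite inE -(prev_rot i Uc) E1 (@prev_cat_last _ (v :: w :: B1)) // => /andP [].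
have U2 := Ur; rewrite E2 in U2; move: bS; rewrite inE -(prev_rot i Uc) E2.
by rewrite (@prev_cat_last _ (v :: w :: B1 ++ a :: B2)) //= last_cat => /andP [].
Qed.

(** Otherwise [no_cross] applies to the arcs from [l] to [f], from [next c f] to just before [r],
    and from [r] to just before [l]. *)
Lemma separating_pos f l : l \in succs c x -> f \in runs -> e r f -> e l (next c f) ->
  pos f < pos l.
Proof.
move=> lS fR rf lg.
have [fO gO] : f \in outer /\ next c f \in outer by apply/andP; rewrite inE in fR.
have fc := outer_mem fO.
have rl : r != l.
  by apply: contraTneq lg => <-; apply: run_no_common => //; apply: succs_skippable.
rewrite ltnNge; apply/negP => le_lf.
have [P [Q [E2 lP lQ]]] := rot_to2_at Uc E (succs_mem lS) rl.
have fQ : f \in l :: Q.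
  move: le_lf; rewrite /pos E2 !index_cat.
  have -> : l \in r :: P = false.
    by move: Ur; rewrite E2 uniq_catC /= mem_cat negb_or => /andP [/andP [_ /negPf ->]].
  rewrite index_head addn0; case: ifP => [fP|fP _].
    by rewrite leqNgt index_mem fP.
  by move: fc; rewrite -(mem_rot i c) E2 mem_cat fP.
have fl : f != l by apply: contraTneq fO => ->; apply: succs_inner.
rewrite inE (negPf fl) /= in fQ.
case/splitPr: fQ E2 lQ => Q1 Q2 E2 lQ.
have U2 : uniq (((r :: P) ++ l :: Q1) ++ f :: Q2) by rewrite -catA -E2.
case: Q2 E2 lQ U2 => [|g Q2] E2 lQ U2.
  have : prev c r = f by rewrite lQ last_cat.
  move=> h; have := succs_inner rS.
  by rewrite -(next_prev Uc r) h gO.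
have E2' : rot i c = ((r :: P) ++ l :: Q1) ++ f :: g :: Q2 by rewrite E2 -catA.
have Eg : next c f = g by rewrite -(next_rot i Uc) E2' next_cat.
have E3 : rot i c = (r :: P) ++ (l :: Q1 ++ f :: g :: Q2) by rewrite E2.
have [j Ej] := rot_swap E3.
have Ej' : rot j c = (l :: Q1 ++ [:: f]) ++ (g :: Q2) ++ r :: P.
  by rewrite Ej /= -!catA.
apply: (no_cross Ej').
- by rewrite -Eg.
- by rewrite last_cat.
- by move: rS; rewrite inE lQ last_cat /= => /andP [].
by move: lS; rewrite inE lP => /andP [].
Qed.

(** [l1] is the last successor other than [r] seen by [v], [l] the first seen by [w]; [c'] skips [r]
    by reversing the arc that starts at [l1]. The vertices before the runs separating [r] from [l]
    all lie in [Z], and [Z] has no room for more: every estimate is an equality. *)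
Lemma first_run_step :
  [/\ 2 * #|frame c x| = 3 * (k - 1) + 2, e x w,
      #|core| + #|twice_missed v| = 2 * (k - 1) &
      exists r', [/\ r' \in succs c x, next c r' \in runs &
        forall a, a \in succs c x -> pos a <= pos r']].
Proof.
have [b0 [b0S b0r b0v]] := succ_other rS.
pose A1 := [pred b | [&& b \in succs c x, b != r & e v b]].
have A1b0 : A1 b0 by apply/and3P.
have [l1 /and3P [l1S l1r vl1] l1max] := arg_maxnP pos A1b0.
have [l0 l0S l0w] := outer_succ wO.
pose A2 := [pred b | (b \in succs c x) && e w b].
have A2l0 : A2 l0 by apply/andP.
have [l /andP [lS wl] lmin] := arg_minnP pos A2l0.
have [P2 [Q [E2 xP2 xQ sk]]] := succs_skip E rS l1S l1r vl1.
rewrite -/v in E2 xP2 sk; set c' := _ :: _ in sk.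
have [L' rc' _ _] := sk.
have Uc' : uniq c' by case: L'.
have nvw : next c' v = w.
  have Ew : next (rot i c) v = w by rewrite next_rot.
  case: P2 E2 xP2 @c' sk L' rc' Uc' => [|g P2] E2 xP2 c' sk L' rc' Uc'.
    have U2 := Ur; rewrite E2 in U2.
    move: Ew; rewrite E2 (@next_cat _ [:: r] Q v l1 U2) => Ew.
    by have := succs_inner l1S; rewrite Ew wO.
  have U2 := Ur; rewrite E2 in U2.
  move: Ew; rewrite E2 (@next_cat _ [:: r] (P2 ++ l1 :: Q) v g U2) => <-.
  by rewrite /c' -cat_cons next_cat.
have rO := succs_inner rS; have lO := succs_inner lS; have lsk := succs_skippable lS.
have rv' : e r v by rewrite esym v_adj_r.
have lw : e l (next c' v) by rewrite nvw esym.
have h1 := seps_card sk rv' lw.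
(* By the order of the neighbours of [v] and [w], a successor before [l] or after [l1], other than
   [r], is missed by both ends of the run. *)
pose Z := (core :\: frame c x) :|: [set r; l1] :|: (twice_missed v :&: succs c x).
have lt_ll1 : pos l < pos l1 by apply: w_pos_lt_v.
have late p : p \in succs c x -> pos l1 <= pos p -> p \in Z.
  move=> pS; rewrite leq_eqVlt => /predU1P [Ep|lt_p].
    by rewrite -(pos_inj (succs_mem l1S) (succs_mem pS) Ep) /Z !in_setU !in_set1 eqxx !orbT.
  have pr : p != r by rewrite eq_sym -pos_r -lt0n; apply: leq_ltn_trans lt_p.
  rewrite /Z in_setU in_setI pS andbT [p \in twice_missed v]inE succs_core //=.
  suff [-> ->] : ~~ e v p /\ ~~ e w p by rewrite orbT.
  split; apply/negP => h.
    by have := l1max p; rewrite /= pS pr h => /(_ isT); rewrite leqNgt lt_p.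
  by have := w_pos_lt_v l1S l1r vl1 pS h; rewrite ltnNge (ltnW lt_p).
have early p : p \in succs c x -> pos p < pos l -> p \in Z.
  move=> pS lt_p; case: (eqVneq p r) => [->|pr].
    by rewrite /Z !in_setU !in_set1 eqxx !orbT.
  rewrite /Z in_setU in_setI pS andbT [p \in twice_missed v]inE succs_core //=.
  suff [-> ->] : ~~ e v p /\ ~~ e w p by rewrite orbT.
  split; apply/negP => h.
    by have := w_pos_lt_v pS pr h lS wl; rewrite ltnNge (ltnW lt_p).
  by have := lmin p; rewrite /= pS h => /(_ isT); rewrite leqNgt lt_p.
pose phi y := prev c (run_start c' y).
have phiZ y : y \in seps c' r l -> phi y \in Z.
  move=> yS; have [sR hs] := run_startP sk rO lO yS.
  have [yO yc' ly rq qO] := sepsP sk rO lO yS.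
  have sO : run_start c' y \in outer by move: sR; rewrite inE => /andP [].
  have pC : phi y \in core by apply/setUP; right; apply: imset_f.
  have pc : phi y \in c by rewrite mem_prev outer_mem.
  case: (boolP (phi y \in frame c x)) => pF; last by rewrite /Z !in_setU in_setD pC pF.
  have pS : phi y \in succs c x by move: pF; rewrite in_frame pc inE pc.
  have sr : run_start c' y != r by apply: contraNneq rO => <-.
  have ps : pos (run_start c' y) = (pos (phi y)).+1.
    by rewrite -pos_next // /phi next_prev.
  (* A run followed forwards by [c'] starts before [l]; one followed backwards lies on the reversed
     arc, beyond [l1]. *)
  case: hs => -[Ey Eq].
    apply: early => //; rewrite -ltnS -ps ltnS ltnW //.
    by apply: separating_pos; rewrite ?Eq // -Eq -?Ey.
  apply: late => //; rewrite -ltnS -ps -Ey.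
  have yrev : y \in l1 :: Q.
    have yx : y != x by apply: contraTneq yO => ->; apply: frame_inner; apply: x_frame.
    move: (yc'); rewrite /c' inE (negPf yx) mem_cat mem_rev /= => /orP [//|yP].
    exfalso; case/splitPr: yP E2 @c' Uc' yc' yS qO Eq Ey sR {sk L' rc' nvw lw h1 xP2 phi rq pC pc pF pS sr ps sO}
      => S1 S2 E2 c' Uc' yc' yS qO Eq Ey sR.
    elim/last_ind: S1 E2 @c' Uc' yc' yS qO Eq Ey sR => [|S1 p _] E2 c' Uc' yc' yS qO Eq Ey sR.
      move: qO; rewrite /c' prev_cat_last // last_rev_cons.
      by apply/negP; apply: succs_inner.
    have Ep : prev c' y = p.
      by rewrite /c' cat_rcons -cat_cons catA prev_cat // -catA -cat_rcons.
    have E3 : rot i c = (r :: S1) ++ p :: y :: (S2 ++ l1 :: Q).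
      by rewrite E2 cat_rcons /= -catA.
    have np : next c p = y by rewrite -(next_rot i Uc) E3 next_cat // -E3.
    have : y = p by rewrite {1}Ey /run_start Ep np eqxx.
    move=> Eyp; have := next_cycle Cc (outer_mem yO).
    by rewrite Eyp np Eyp eirr.
  have yl1 : y != l1 by apply: contraTneq yO => ->; apply: succs_inner.
  rewrite inE (negPf yl1) /= in yrev.
  move: Ur; rewrite E2 cat_uniq => /and3P [_ /hasPn dis _].
  have := dis y; rewrite inE yrev orbT => /(_ isT) /negPf yP.
  have := dis l1; rewrite mem_head => /(_ isT) /negPf l1P.
  rewrite /pos E2 !index_cat; move: yP l1P => /= -> ->.
  by rewrite eqxx eq_sym (negPf yl1) addn0 addnS leq_addr.
have phi_inj := prev_run_start_inj sk rO lO lsk.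
have subZ : phi @: seps c' r l \subset Z.
  by apply/subsetP => _ /imsetP [y yS ->]; apply: phiZ.
have card_phi : #|phi @: seps c' r l| = #|seps c' r l| by apply: card_in_imset.
have h2 := subset_leq_card subZ; rewrite card_phi in h2.
have h3 : #|Z| <= #|core :\: frame c x| + 2 + #|twice_missed v :&: succs c x|.
  apply: leq_trans (leq_card_setU _ _) _; rewrite leq_add2r.
  apply: leq_trans (leq_card_setU _ _) _; rewrite leq_add2l.
  by rewrite cards2; case: eqP.
have h4 : #|core :\: frame c x| + #|frame c x| = #|core|.
  rewrite addnC -(cardsID (frame c x) core); congr (#|pred_of_set _| + _).
  by symmetry; apply/setIidPr/subsetUl.
have h5 := core_card vR; rewrite -/v in h5.
(* Unless it sees [w], [x] is twice missed without being a successor; this extra unit would break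
   the equality. *)
have h6 : #|twice_missed v :&: succs c x| + ~~ e x w <= #|twice_missed v|.
  case: (boolP (e x w)) => xw; rewrite ?addn0 ?addn1.
    exact: subset_leq_card (subsetIl _ _).
  apply: proper_card; apply/properP; split; first exact: subsetIl.
  exists x; last by rewrite in_setI negb_and [x \in succs c x]inE (negPf xc) orbT.
  rewrite inE in_setU x_frame /= ![e _ x]esym -/w xw andbT.
  exact: next_outer_not_nbr.
have h7 := frame_lb.
have h8 : 3 * (k - 1) + 2 <= 2 * #|frame c' r|.
  by rewrite (card_frame L' rc'); have := deg_k r; have := card_off_gt0 rc'; card_lia.
(* The chain gives [3 * (k - 1) + 2] as an upper bound for the sum of the frames of [x] and [r],
   while the degree bound gives each at least half of it. *)
have eqZ : #|Z| <= #|seps c' r l|.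
  move: h1 h2 h3 h4 h5 h6 h7 h8; case: (e x w) => /=; card_lia.
split.
- by move: h1 h2 h3 h4 h5 h6 h7 h8; case: (e x w) => /=; card_lia.
- by move: h1 h2 h3 h4 h5 h6 h7 h8; case: (e x w) => //=; card_lia.
- by move: h1 h2 h3 h4 h5 h6 h7 h8; case: (e x w) => /=; card_lia.
(* The last successor lies in [Z], so by equality it precedes a run. *)
have [r' r'S r'max] := arg_maxnP pos rS.
have r'Z : r' \in Z by apply: late => //; apply: r'max.
have EZ : phi @: seps c' r l = Z by apply/eqP; rewrite eqEcard subZ card_phi.
exists r'; split => //.
move: r'Z; rewrite -EZ => /imsetP [y yS ->]; rewrite /phi next_prev //.
by have [] := run_startP sk rO lO yS.
Qed.

End FirstRun.

(** * The cycle splits into triples *)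

Definition firsts := [set r in succs c x | next c r \in runs].

Lemma first_runP r : r \in firsts ->
  [/\ r \in succs c x, next c r \in runs, next c r \in outer & next c (next c r) \in outer].
Proof.
rewrite inE => /andP [rS rR].
by have /andP [vO wO] : (next c r \in outer) && (next c (next c r) \in outer);
  [rewrite inE in rR | split].
Qed.

Lemma firsts_nbr r : r \in firsts -> e x (next c (next c r)).
Proof.
case/first_runP => rS rR _ _; have [i B E] := rot_to (succs_mem rS).
by have [] := first_run_step rS rR E.
Qed.

(** The last successor [r'] before returning to [r] precedes a run whose second end is seen by [x].
    So the vertex three steps after [r'] is a successor, and it can only be [r]. *)
Lemma firsts_prev3 r : r \in firsts -> prev c (prev c (prev c r)) \in firsts.
Proof.
case/first_runP => rS rR _ _; have [i B E] := rot_to (succs_mem rS).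
have [_ _ _ [r' [r'S r'R r'max]]] := first_run_step rS rR E.
have r'F : r' \in firsts by rewrite inE r'S.
have [_ _ tO uO] := first_runP r'F; have xu := firsts_nbr r'F.
suff <- : next c (next c (next c r')) = r by rewrite !prev_next.
apply/eqP; apply: contraT => sr; have rO := succs_inner rS.
have := r'max _ (next_nbr xu).
rewrite (pos_next E (outer_mem uO) sr).
rewrite (pos_next E (outer_mem tO)); last by apply: contraNneq rO => <-.
rewrite (pos_next E (succs_mem r'S)); last by apply: contraNneq rO => <-.
by rewrite ltnNge leqW // leqW.
Qed.

Hypothesis firsts0 : firsts != set0.

(** Walking backwards from one element of [firsts] reaches all of [c] and meets another one after
    every three steps. *)
Lemma triples y : y \in c ->
  [|| y \in firsts, prev c y \in firsts | prev c (prev c y) \in firsts].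
Proof.
case/set0Pn: firsts0 => r rF yc; have [rS _ _ _] := first_runP rF.
have fc : fcycle (prev c) (rev c).
  rewrite -(eq_cycle (e := frel (next (rev c)))); first by apply: cycle_next; rewrite rev_uniq.
  by move=> u w /=; rewrite next_rev.
have rc : r \in rev c by rewrite mem_rev succs_mem.
have : fconnect (prev c) r y by rewrite (fconnect_cycle fc rc) mem_rev.
move/iter_findex => <-; elim: (findex _ _ _) => [|n IH] /=; first by rewrite rF.
case/or3P: IH => h; rewrite ?h ?orbT //.
by rewrite firsts_prev3 ?orbT.
Qed.

Lemma succs_firsts s : s \in succs c x -> s \in firsts.
Proof.
move=> sS; have sO := succs_inner sS.
case/or3P: (triples (succs_mem sS)) => // /first_runP [_ _ h1 h2].
  by rewrite next_prev // (negPf sO) in h1.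
by rewrite !next_prev // (negPf sO) in h2.
Qed.

Lemma run_firsts f : f \in runs -> prev c f \in firsts.
Proof.
rewrite inE => /andP [fO gO]; case/or3P: (triples (outer_mem fO)) => // h.
  by have [/succs_inner] := first_runP h; rewrite fO.
have := firsts_nbr h; rewrite !next_prev // => xf.
by have := next_outer_not_nbr gO; rewrite xf.
Qed.

Lemma core_frame : core = frame c x.
Proof.
apply/setUidPl/subsetP => _ /imsetP [f /run_firsts h ->].
by have [fS _ _ _] := first_runP h; apply: succs_frame.
Qed.

Lemma tight_degrees : #|~: [set y in c]| = 1 /\ 2 * deg e x = 3 * (k - 1).
Proof.
case/set0Pn: firsts0 => r rF; have [rS rR _ _] := first_runP rF.
have [i B E] := rot_to (succs_mem rS); have [h _ _ _] := first_run_step rS rR E.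
move: h; rewrite (card_frame L xc); move: (card_off_gt0 xc) (deg_k x); clear.
move: (card _) (deg _ _) => m d.
by move=> *; split; lia.
Qed.

(** [a] sees at most one end of each run, and by [tight_degrees] it has at least as many neighbours
    as there are successors, one per run; so it sees an end of each. *)
Lemma succ_meets_run a r : a \in succs c x -> r \in firsts ->
  e a (next c r) || e a (next c (next c r)).
Proof.
move=> aS rF; have aO := succs_inner aS; have [rS _ _ _] := first_runP rF.
pose h o := if prev c o \in succs c x then prev c o else prev c (prev c o).
have hP o : e a o -> h o \in succs c x /\
    (o = next c (h o) \/ o = next c (next c (h o))).
  move=> ao; have oO := adj_inner aO ao; rewrite /h.
  case: ifP => pS; first by split => //; left; rewrite next_prev.
  case/or3P: (triples (outer_mem oO)) => /first_runP [h1 _ _ _].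
  - by have := succs_inner h1; rewrite oO.
  - by rewrite h1 in pS.
  by split => //; right; rewrite !next_prev.
have h_inj : {in [set o | e a o] &, injective h}.
  move=> o o'; rewrite !inE => ao ao' Eh.
  have [hS ho] := hP _ ao; have [_ ho'] := hP _ ao'; rewrite -Eh in ho'.
  have [_ hR _ _] := first_runP (succs_firsts hS).
  have nc := run_no_common hR (succs_skippable aS).
  move: (h o) ho ho' nc {Eh hS hR} => s [] Eo [] Eo' nc.
  - by rewrite Eo Eo'.
  - by have := nc; rewrite -Eo' -Eo ao ao' => /(_ isT).
  - by have := nc; rewrite -Eo -Eo' ao ao' => /(_ isT).
  by rewrite Eo Eo'.
have sub : h @: [set o | e a o] \subset succs c x.
  by apply/subsetP => u /imsetP [o]; rewrite inE => /hP [hS _] ->.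
have [_ dx] := tight_degrees.
have Eh : h @: [set o | e a o] = succs c x.
  apply/eqP; rewrite eqEcard sub card_in_imset // (card_succs L xc).
  by have := deg_k a; rewrite -/(deg e a) -dx leq_pmul2l.
move: rS; rewrite -Eh => /imsetP [o]; rewrite inE => ao Er.
have [_] := hP _ ao; rewrite -Er => -[] Eo; move: ao; rewrite {1}Eo => ->//.
by rewrite orbT.
Qed.

(** No frame vertex is twice missed, so the frame has [2 * (k - 1)] vertices, while twice its size
    is [3 * (k - 1) + 2]. *)
Lemma k_eq3 : k = 3.
Proof.
case/set0Pn: firsts0 => r rF; have [rS rR _ _] := first_runP rF.
have [i B E] := rot_to (succs_mem rS); have [h xw h2 _] := first_run_step rS rR E.
have [X1 _] := tight_degrees.
have tm0 : twice_missed (next c r) = set0.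
  apply/setP => z; rewrite [LHS]inE in_set0 core_frame in_frame.
  apply/negP => /and3P [zF vz wz]; case: (boolP (z \in c)) zF => zc /= zF.
    have zS : z \in succs c x by rewrite inE zc.
    have := succ_meets_run zS rF; rewrite ![e z _]esym.
    by rewrite (negPf vz) (negPf wz).
  have Ezx : z = x.
    move/eqP/cards1P: X1 => [t Et].
    have : x \in ~: [set y in c] by rewrite !inE.
    have : z \in ~: [set y in c] by rewrite !inE.
    by rewrite Et !in_set1 => /eqP -> /eqP ->.
  by rewrite Ezx esym xw in wz.
move: h h2; rewrite tm0 cards0 core_frame; move: k2; clear.
by move: (card _) => n; lia.
Qed.

Lemma triple_cycle : exists i a0 a1 a2 a3 a4 a5 a6 a7 a8,
  [/\ rot i c = [:: a0; a1; a2; a3; a4; a5; a6; a7; a8], e x a2, e x a5, e x a8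
    & #|T| = 10].
Proof.
have [X1 dx] := tight_degrees; have k3 := k_eq3.
have d3 : #|succs c x| = 3 by rewrite (card_succs L xc); move: dx; rewrite k3; lia.
have nI := can_inj (prev_next Uc).
(* The three successors and their first and second shifts partition the cycle. *)
have c9 : #|[set y in c]| = 9.
  pose S := succs c x; pose S1 := next c @: S; pose S2 := next c @: S1.
  have S1O s : s \in S1 -> s \in outer.
    by case/imsetP => u /succs_firsts /first_runP [_ _ h _] ->.
  have S2O s : s \in S2 -> s \in outer.
    by case/imsetP => u /imsetP [u' /succs_firsts /first_runP [_ _ _ h] ->] ->.
  have -> : [set y in c] = S :|: (S1 :|: S2).
    apply/setP => y; rewrite inE !in_setU; apply/idP/idP => [yc|].
      case/or3P: (triples yc) => /first_runP [h _ _ _]; first by rewrite -/S h.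
        by apply/or3P; apply: Or32; rewrite -[y](next_prev Uc); apply: imset_f.
      apply/or3P; apply: Or33; rewrite -[y](next_prev Uc); apply: imset_f.
      by rewrite -[prev c y](next_prev Uc); apply: imset_f.
    by case/or3P => [/succs_mem|/S1O /outer_mem|/S2O /outer_mem].
  rewrite cardsU [S :&: _](_ : _ = set0); last first.
    apply/setP => y; rewrite in_set0 in_setI in_setU; apply/negP => /andP [/succs_inner h].
    by case/orP => [/S1O|/S2O]; rewrite (negPf h).
  rewrite cards0 subn0 cardsU [S1 :&: _](_ : _ = set0); last first.
    apply/setP => y; rewrite in_set0 in_setI; apply/negP => /andP [/imsetP [u uS ->]].
    case/imsetP => u' /S1O u'O /nI Eu; move: (succs_inner uS).
    by rewrite Eu u'O.
  by rewrite cards0 subn0 !card_imset // /S d3.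
have sc : size c = 9 by rewrite -c9 cardsE; symmetry; apply/card_uniqP.
have T10 : #|T| = 10 by rewrite -(cardsC [set y in c]) c9 X1.
case/set0Pn: firsts0 => r rF; have [rS _ _ _] := first_runP rF.
have [i B E] := rot_to (succs_mem rS).
have : size (r :: B) = 9 by rewrite -E size_rot.
case: B E => [|a1 [|a2 [|a3 [|a4 [|a5 [|a6 [|a7 [|a8 [|]]]]]]]]] // E _.
have U := Uc; rewrite -(rot_uniq i) E in U.
have n0 : next c r = a1 by rewrite -(next_rot i Uc) E (@next_cat _ [::]).
have n1 : next c a1 = a2 by rewrite -(next_rot i Uc) E (@next_cat _ [:: r]).
have n2 : next c a2 = a3 by rewrite -(next_rot i Uc) E (@next_cat _ [:: r; a1]).
have n3 : next c a3 = a4 by rewrite -(next_rot i Uc) E (@next_cat _ [:: r; a1; a2]).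
have n4 : next c a4 = a5 by rewrite -(next_rot i Uc) E (@next_cat _ [:: r; a1; a2; a3]).
have p0 : prev c r = a8 by rewrite -(prev_rot i Uc) E prev_head.
have x2 : e x a2 by rewrite -n1 -n0 firsts_nbr.
have a3F : a3 \in firsts by rewrite -n2 succs_firsts // next_nbr.
exists i, r, a1, a2, a3, a4, a5, a6, a7, a8; split => //.
- by rewrite -n4 -n3 firsts_nbr.
by move: rS; rewrite inE p0 => /andP [].
Qed.

End Config.

(** Without runs, [prev c] maps the outer vertices injectively into the inner ones and never reaches
    [x], so the independent set of inner vertices would exceed half of the graph. *)
Lemma runs_nonempty c x : longest c -> x \notin c ->
  (forall I : {set T}, independent e I -> 2 * #|I| <= #|T|) -> runs c x != set0.
Proof.
move=> L xc tough; apply/negP => /eqP R0; have U : uniq c by case: L.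
have ind : independent e (~: outer c x).
  by apply/indepP => y z; rewrite !in_setC; apply: (inner_indep L xc).
have := tough _ ind; rewrite -(cardsC (outer c x)).
suff : #|outer c x| < #|~: outer c x| by card_lia.
rewrite -(card_imset (outer c x) (can_inj (prev_next U))).
apply: proper_card; apply/properP; split.
  apply/subsetP => z /imsetP [o oO ->]; rewrite in_setC.
  by apply/negP => nO; have := in_set0 o; rewrite -R0 inE oO nO.
exists x; first by rewrite in_setC (frame_inner L xc) // x_frame.
apply/negP => /imsetP [o oO Ex]; have := outer_mem L xc oO.
by rewrite -(mem_next c) -Ex (negPf xc).
Qed.

(** * Recognising the Petersen graph *)

Lemma triple_adj x a0 a1 a2 a3 a4 a5 a6 a7 a8 : k = 3 ->
  longest [:: a0; a1; a2; a3; a4; a5; a6; a7; a8] ->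
  x \notin [:: a0; a1; a2; a3; a4; a5; a6; a7; a8] ->
  e x a2 -> e x a5 -> e x a8 ->
  [/\ e a1 a3 = false, e a1 a6, e a2 a0 = false, e a2 a6 = false & e a0 a3 = false]
  /\ (e x a0 = false /\ e x a1 = false).
Proof.
move=> k3; set c := [:: _, _ & _] => L xc x2 x5 x8.
have U : uniq c by case: L.
have C : cycle e c by case: L.
have n0 : next c a0 = a1 by rewrite (@next_cat _ [::]).
have n1 : next c a1 = a2 by rewrite (@next_cat _ [:: a0]).
have n2 : next c a2 = a3 by rewrite (@next_cat _ [:: a0; a1]).
have n5 : next c a5 = a6 by rewrite (@next_cat _ [:: a0; a1; a2; a3; a4]).
have n8 : next c a8 = a0 by rewrite (@next_last _ (behead c) a0).
have S0 : a0 \in succs c x by rewrite -n8 next_nbr.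
have S3 : a3 \in succs c x by rewrite -n2 next_nbr.
have S6 : a6 \in succs c x by rewrite -n5 next_nbr.
have xF := x_frame xc.
have F0 := succs_frame S0; have F3 := succs_frame S3; have F6 := succs_frame S6.
have O1 : a1 \in outer c x.
  by rewrite -n0 next_inner ?(succs_inner L xc) ?(succs_mem S0).
have O2 : a2 \in outer c x by apply: (adj_inner L xc (frame_inner L xc xF)).
have R1 : a1 \in runs c x by rewrite inE O1 n1.
have e10 : e a1 a0 by rewrite esym -n0; apply: next_cycle => //; apply: succs_mem S0.
have e23 : e a2 a3 by rewrite -n2; apply: next_cycle => //; apply: (outer_mem L xc).
have nc z : z \in succs c x -> e a1 z -> e a2 z = false.
  move=> zS; have := run_no_common L xc R1 (succs_skippable L xc zS).
  by rewrite n1 ![e z _]esym => h /h /negPf.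
have e13 : e a1 a3 = false by apply/negP => /(nc _ S3); rewrite e23.
have ex1 : e x a1 = false.
  by apply/negP => /(next_nbr L xc) /(succs_inner L xc); rewrite n1 O2.
have ind := indepP _ (frame_indep L xc).
(* Otherwise the outer [a1] misses the three frame vertices [x], [a3], [a6], too many for
   [k = 3]. *)
have e16 : e a1 a6.
  apply: contraT => e16.
  have := @missed_outer c x L xc (frame c x) a1 (fun z => frame_inner L xc (y := z)) O1.
  rewrite ltnNge k3; apply: contraNT => _.
  apply/card_geqP; exists [:: x; a3; a6]; split => //.
    rewrite /= !inE negb_or andbT -andbA; apply/and3P; split.
    - by apply: contraNneq xc => ->; apply: succs_mem S3.
    - by apply: contraNneq xc => ->; apply: succs_mem S6.
    by apply/eqP => E36; move: U; rewrite /c E36 /= !inE eqxx !orbT /= !andbF.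
  move=> z; rewrite mem_seq3 => /or3P [] /eqP ->; rewrite inE.
  - by rewrite xF esym ex1.
  - by rewrite F3 e13.
  by rewrite F6 e16.
split; last by split => //; exact: (negPf (ind x a0 xF F0)).
split => //; [exact: nc | exact: nc | exact: (negPf (ind a0 a3 F0 F3))].
Qed.

(** The symmetries of the 9-cycle that preserve the places of the neighbours of [x] carry
    [triple_adj] to all pairs except those among these neighbours, which are treated separately. *)
Lemma petersen_of_triples x a0 a1 a2 a3 a4 a5 a6 a7 a8 : k = 3 -> #|T| = 10 ->
  longest [:: a0; a1; a2; a3; a4; a5; a6; a7; a8] ->
  x \notin [:: a0; a1; a2; a3; a4; a5; a6; a7; a8] ->
  e x a2 -> e x a5 -> e x a8 -> is_petersen e.
Proof.
move=> k3 T10 L xc x2 x5 x8; set c := [:: _, _ & _] in L xc.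
have rot_facts j : longest (rot j c) /\ x \notin rot j c.
  by split; [apply: longest_rot | rewrite mem_rot].
have rev_facts j : longest (rot j (rev c)) /\ x \notin rot j (rev c).
  by split; [apply/longest_rot/longest_rev | rewrite mem_rot mem_rev].
have [[A1 A2 A3 A4 A5] [A6 A7]] := triple_adj k3 L xc x2 x5 x8.
have [L3 xc3] := rot_facts 3; have [L6 xc6] := rot_facts 6.
have [[B1 B2 B3 B4 B5] [B6 B7]] := triple_adj k3 L3 xc3 x5 x8 x2.
have [[C1 C2 C3 C4 C5] [C6 C7]] := triple_adj k3 L6 xc6 x8 x2 x5.
(* These offsets put [a2], [a5], [a8] back at places 2, 5 and 8 of the reversed cycle. *)
have [K1 xk1] := rev_facts 7; have [K2 xk2] := rev_facts 4; have [K3 xk3] := rev_facts 1.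
have [[D1 D2 D3 D4 D5] _] := triple_adj k3 K1 xk1 x8 x5 x2.
have [[E1 E2 E3 E4 E5] _] := triple_adj k3 K2 xk2 x2 x8 x5.
have [[F1 F2 F3 F4 F5] _] := triple_adj k3 K3 xk3 x5 x2 x8.
have U : uniq c by case: L.
have : cycle e c by case: L.
rewrite /c /= !andbT.
case/and5P => G0 G1 G2 G3 /and5P [G4 G5 G6 G7 G8].
(* An edge between two neighbours of [x] would complete a cycle through all ten vertices. *)
have nouu b0 b1 b2 b3 b4 b5 b6 b7 b8 : perm_eq [:: b0; b1; b2; b3; b4; b5; b6; b7; b8] c ->
    e b2 b1 -> e b1 b0 -> e b0 b4 -> e b4 b3 -> e b3 b7 -> e b7 b6 -> e b6 b5 -> e b5 x -> e x b8 ->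
    e b8 b2 = false.
  move=> pe *; apply/negP => h.
  apply: (@not_longer c [:: x; b8; b2; b1; b0; b4; b3; b7; b6; b5]) => //.
    have p2 : perm_eq [:: b8; b2; b1; b0; b4; b3; b7; b6; b5] c.
      rewrite -(permPr pe); apply/permP => p /=.
      do 9 move: (nat_of_bool (p _)) => ?; clear; lia.
    by rewrite cons_uniq (perm_mem p2) xc (perm_uniq p2).
  by rewrite /=; do !(apply/andP; split).
have uu1 : e a8 a2 = false.
  by apply: (nouu a0 a1 a2 a3 a4 a5 a6 a7 a8) => //; rewrite esym.
have uu2 : e a2 a5 = false.
  apply: (nouu a3 a4 a5 a6 a7 a8 a0 a1 a2) => //; try by rewrite esym.
  by rewrite -[X in perm_eq X]/(rot 3 c) perm_rot.
have uu3 : e a5 a8 = false.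
  apply: (nouu a6 a7 a8 a0 a1 a2 a3 a4 a5) => //; try by rewrite esym.
  by rewrite -[X in perm_eq X]/(rot 6 c) perm_rot.
pose vs := x :: c.
have Uvs : uniq vs by rewrite /= xc.
have inv y : y \in vs.
  have /eqP := eq_refl #|T|; rewrite {1}T10 -[10]/(size vs) -(card_uniqP Uvs) => h.
  have : y \in T by []; by rewrite -(subset_cardP h (subset_predT _)).
(* Only a default for [nth]: all indices used are below ten. *)
pose p0 := head (pair_vertex (isT : Ordinal (isT : 0 < 5) != Ordinal (isT : 1 < 5))) petersen_list.
pose f y := nth p0 petersen_list (index y vs).
have lt_index y : index y vs < 10 by rewrite -[10]/(size vs) index_mem.
exists f; split.
  apply: inj_card_bij; last by rewrite card_petersen_vertex T10.
  move=> y z /eqP; rewrite nth_uniq ?petersen_list_uniq ?lt_index // => /eqP h.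
  by rewrite -(nth_index x (inv y)) h nth_index.
suff adj i j : i < 10 -> j < 10 ->
    e (nth x vs i) (nth x vs j) = petersen_adj (nth p0 petersen_list i) (nth p0 petersen_list j).
  by move=> y z; rewrite -adj ?lt_index // !nth_index.
do 10 (case: i => [_|i]; [do 10 (case: j => [_|j];
  [rewrite [RHS]pair_vertex_adj /= ?eirr //; first [assumption | rewrite esym; assumption] |]) => // |]) => //.
Qed.

End LongestCycles.

Theorem theorem1p6 (T : finType) (e : rel T) (k : nat) :
  simple_graph e ->
  2 <= k ->
  k_connected k e ->
  K2_kK1_free k e ->
  3 * (k - 1) <= 2 * min_degree e ->
  2 * alpha e <= #|T| ->
  hamiltonian e \/ is_petersen e.
Proof.
move=> [esym eirr] k2 [kT conn] free dmin tough.
have deg_k v : 3 * (k - 1) <= 2 * deg e v.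
  apply: leq_trans dmin _; rewrite leq_mul2l /=.
  by apply/bigmax_leqP => d /forallP.
have toughI (I : {set T}) : independent e I -> 2 * #|I| <= #|T|.
  move=> iI; apply: leq_trans tough; rewrite leq_mul2l /=.
  exact: (@leq_bigmax_cond _ _ (fun S : {set T} => #|S|)).
have [c L] : exists c, longest e c by apply: (exists_longest (k := k)) => //; apply: leq_trans kT.
have [U C s2 _] := L.
case: (eqVneq (size c) #|T|) => [Ec|nc]; first by left; exists c.
right.
have [x xc] : exists x, x \notin c.
  apply/existsP; rewrite -negb_forall; apply: contraNN nc => /forallP h.
  by rewrite -(card_uniqP U); apply/eqP/eq_card => y; rewrite h.
have R0 := runs_nonempty esym eirr free deg_k k2 conn L xc toughI.
have [f fR fS] := exists_first_run esym eirr free deg_k k2 conn L xc R0.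
have F0 : firsts e c x != set0.
  by apply/set0Pn; exists (prev c f); rewrite inE fS next_prev.
have [i [a0 [a1 [a2 [a3 [a4 [a5 [a6 [a7 [a8 [E x2 x5 x8 T10]]]]]]]]]]] :=
  triple_cycle esym eirr free deg_k k2 conn L xc F0.
apply: (@petersen_of_triples T e k esym eirr free deg_k k2 conn x a0 a1 a2 a3 a4 a5 a6 a7 a8) => //.
- exact: (k_eq3 esym eirr free deg_k k2 conn L xc F0).
- by rewrite -E; apply: longest_rot.
by rewrite -E mem_rot.
Qed.
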